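(* Let $L\in\mathbb{Q}^n$ be a weight vector on $R_A$ and $I_A^L:=\operatorname{gr}^L(I_A)\subseteq R_A$. (a) The set of $\mathbb{Z}^d$-graded prime ideals of $R_A$ containing $I_A^L$ equals $\{I_A^\tau:\tau\in\Phi_A^L\}$. (b) One has $$\operatorname{Var}(I_A^L)=\bigcup_{\tau\in\Phi_A^{L,d-1}}\overline{O_A^\tau}=\bigsqcup_{\tau\in\Phi_A^L}O_A^\tau\subseteq\widehat{\mathbb{C}}^n,$$ where $\Phi_A^{L,d-1}$ is the set of $(d-1)$-dimensional faces in $\Phi_A^L$.
   Context: $A=(\mathbf a_1,\dots,\mathbf a_n)\in\mathbb{Z}^{d\times n}$ is full ($\mathbb{Z}A=\mathbb{Z}^d$) and pointed. $R_A=\mathbb{C}[\partial_1,\dots,\partial_n]$ is $\mathbb{Z}^d$-graded by $\deg\partial_j=\mathbf a_j$. $I_A$ is the toric ideal, generated by $\partial^{\mathbf u_+}-\partial^{\mathbf u_-}$ for $\mathbf u\in\ker_{\mathbb{Z}}A$. For a weight $L\in\mathbb{Q}^n$, $\operatorname{gr}^L(I_A)$ is the ideal generated by the $L$-initial forms (the parts of maximal $L$-weight) of the elements of $I_A$. The torus $\mathbb{T}=(\mathbb{C}^* )^d$ acts on $\widehat{\mathbb{C}}^n=\operatorname{Spec}R_A$ by $\eta\cdot\xi=(\eta^{\mathbf a_1}\xi_1,\dots,\eta^{\mathbf a_n}\xi_n)$. Subsets $\tau$ of columns of $A$ are identified with index sets. For such $\tau$: - $I_A^\tau$ is the kernel of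 the map $R_A\to\mathbb{C}[t_1^{\pm1},\dots,t_d^{\pm1}]$ with $\partial_j\mapsto t^{\mathbf a_j}$ if $\mathbf a_j\in\tau$ and $\partial_j\mapsto0$ otherwise; - $\mathbf 1_\tau\in\widehat{\mathbb{C}}^n$ is the $0/1$ indicator vector of $\tau$, and $O_A^\tau$ is its $\mathbb{T}$-orbit, with closure $\overline{O_A^\tau}$. $(A,L)$-umbrella. Embed $\mathbb{Q}^d\subseteq\mathbb{P}^d_{\mathbb{Q}}$ via $\mathbf a\mapsto(1:\mathbf a)$ and set $\mathbf a_j^L:=(L_j:\mathbf a_j)$, informally $\mathbf a_j/L_j$, a point at infinity if $L_j=0$. Choose a linear form $f:\mathbb{Z}^d\to\mathbb{Z}$ with $f(\mathbf a_j)>0$ for all $j$, and $\varepsilon>0$ with $f(\mathbf a_j)>\varepsilon|L_j|$ for all $j$. Let $H_\varepsilon=\{(x_0:x):f(x)=-\varepsilon x_0\}$. The $(A,L)$-polyhedron $\Delta_A^L$ is the convex hull of $\{\mathbf 0,\mathbf a_1^L,\dots,\mathbf a_n^L\}$ in the affine space $\mathbb{P}^d_{\mathbb{Q}}\smallsetminus H_\varepsilon$. The $(A,L)$-umbrella $\Phi_A^L$ is the set of faces of $\Delta_A^L$ not containing $\mathbf 0$; each face is identified with the set of $j$ such that $\mathbf a_j^L$ lies on it. *)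

(* Defs.v *)
(* mathcomp algebra + multinomials (mpoly) + real_closed complex.
   The complex numbers are modelled as  R[i] = complex R  for  R : realType
   (every realType is a complete archimedean ordered field, i.e. R). *)
From mathcomp Require Import all_boot all_order all_algebra.
From mathcomp Require Import reals.
From mathcomp.real_closed Require Import complex.
From mathcomp Require Import mpoly.

Set Implicit Arguments.
Unset Strict Implicit.
Unset Printing Implicit Defensive.

Import Order.TTheory GRing.Theory Num.Theory.
Local Open Scope ring_scope.

Section Defs.
Variable R : realType.
Local Notation C := (complex R).
Variables (d n : nat).
Implicit Types (A : 'M[int]_(d, n)).

Definition full A : Prop := forall b : 'cV[int]_d, exists u : 'cV[int]_n, A *m u = b.
Definition lform (f : 'I_d -> int) A (j : 'I_n) : int := \sum_(i < d) f i * A i j.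
Definition pointed A : Prop := exists f : 'I_d -> int, forall j, 0 < lform f A j.

Definition is_ideal (I : {mpoly C[n]} -> Prop) : Prop :=
  [/\ I 0, (forall p q, I p -> I q -> I (p + q)) & (forall p q, I q -> I (p * q))].
Definition prime_ideal (I : {mpoly C[n]} -> Prop) : Prop :=
  [/\ is_ideal I, ~ I 1 & (forall p q, I (p * q) -> I p \/ I q)].
Definition gen_ideal (G : {mpoly C[n]} -> Prop) (p : {mpoly C[n]}) : Prop :=
  exists s : seq ({mpoly C[n]} * {mpoly C[n]}),
    (forall x, x \in s -> G x.2) /\ p = \sum_(x <- s) x.1 * x.2.

Definition Adeg A (m : 'X_{1..n}) : 'cV[int]_d := A *m \col_j ((m j)%:Z).
Definition hcomp A (b : 'cV[int]_d) (p : {mpoly C[n]}) : {mpoly C[n]} :=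
  \sum_(m <- msupp p | Adeg A m == b) p@_m *: 'X_[m].
Definition graded A (I : {mpoly C[n]} -> Prop) : Prop :=
  forall p, I p -> forall b, I (hcomp A b p).

Definition upos (u : 'cV[int]_n) : 'X_{1..n} :=
  [multinom (if (0 <= u j ord0)%R then absz (u j ord0) else 0%N) | j < n].
Definition uneg (u : 'cV[int]_n) : 'X_{1..n} :=
  [multinom (if (u j ord0 < 0)%R then absz (u j ord0) else 0%N) | j < n].
Definition toric_ideal A : {mpoly C[n]} -> Prop :=
  gen_ideal (fun p => exists u : 'cV[int]_n, A *m u = 0 /\ p = 'X_[upos u] - 'X_[uneg u]).

Definition Lwt (L : 'I_n -> rat) (m : 'X_{1..n}) : rat := \sum_j L j * (m j)%:R.
Definition initL (L : 'I_n -> rat) (p : {mpoly C[n]}) : {mpoly C[n]} :=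
  \sum_(m <- msupp p | all (fun m' => Lwt L m' <= Lwt L m) (msupp p)) p@_m *: 'X_[m].
Definition grL (L : 'I_n -> rat) (I : {mpoly C[n]} -> Prop) : {mpoly C[n]} -> Prop :=
  gen_ideal (fun q => exists p, I p /\ q = initL L p).

(* I_A^tau: kernel of  d_j |-> t^{a_j} (j in tau), 0 (j notin tau).
   The image of d^m is t^{Am} if supp m is in tau and 0 otherwise, so p lies in the
   kernel iff for every b the coefficients of the monomials m with supp m in tau and
   Am = b sum to 0. *)
Definition tau_ideal A (tau : {set 'I_n}) (p : {mpoly C[n]}) : Prop :=
  forall b : 'cV[int]_d,
    \sum_(m <- msupp p | (Adeg A m == b) && [forall j, (m j != 0%N) ==> (j \in tau)]) p@_m = 0.

Definition Var (I : {mpoly C[n]} -> Prop) (xi : 'I_n -> C) : Prop :=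
  forall p, I p -> p.@[xi] = 0.
Definition tact A (eta : 'I_d -> C) (xi : 'I_n -> C) : 'I_n -> C :=
  fun j => (\prod_(i < d) eta i ^ (A i j)) * xi j.
Definition ind (tau : {set 'I_n}) : 'I_n -> C := fun j => if j \in tau then 1 else 0.
Definition torus_orbit A (tau : {set 'I_n}) (xi : 'I_n -> C) : Prop :=
  exists eta : 'I_d -> C, (forall i, eta i != 0) /\ forall j, xi j = tact A eta (ind tau) j.
Definition zclosure (S : ('I_n -> C) -> Prop) (xi : 'I_n -> C) : Prop :=
  forall p : {mpoly C[n]}, (forall z, S z -> p.@[z] = 0) -> p.@[xi] = 0.

(* A point (x0 : x) of P^d \ H_eps, H_eps = {f(x) + eps x0 = 0}, is represented in the
   affine chart by its unique representative with f(x) + eps x0 = 1, a row vector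
   (x0, x) in Q^(1+d).  The affine structure of the chart is that of this hyperplane. *)
Definition chartpt (f : 'I_d -> int) (eps : rat) (x0 : rat) (x : 'rV[rat]_d) : 'rV[rat]_(1 + d) :=
  ((\sum_(i < d) (f i)%:~R * x ord0 i) + eps * x0)^-1 *: row_mx (x0%:M) x.
Definition pt0 (f : 'I_d -> int) (eps : rat) : 'rV[rat]_(1 + d) := chartpt f eps 1 0.
Definition ptL A (L : 'I_n -> rat) (f : 'I_d -> int) (eps : rat) (j : 'I_n) : 'rV[rat]_(1 + d) :=
  chartpt f eps (L j) (\row_i (A i j)%:~R).
Definition DeltaAL A L f eps (v : 'rV[rat]_(1 + d)) : Prop :=
  exists (c0 : rat) (c : 'I_n -> rat),
    [/\ 0 <= c0, (forall j, 0 <= c j), c0 + \sum_j c j = 1 &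
        v = c0 *: pt0 f eps + \sum_j c j *: ptL A L f eps j].
(* faces of the polytope Delta (cut out by supporting affine hyperplanes;
   this includes the empty face and Delta itself) *)
Definition is_face (Delta F : 'rV[rat]_(1 + d) -> Prop) : Prop :=
  exists (psi : 'rV[rat]_(1 + d)) (c : rat),
    (forall v, Delta v -> \sum_k psi ord0 k * v ord0 k + c <= 0) /\
    (forall v, F v <-> Delta v /\ \sum_k psi ord0 k * v ord0 k + c = 0).
(* r = maximal number of linearly independent points of F; since the chart is a
   hyperplane not through the origin, dim F = r - 1 *)
Definition maxrank (F : 'rV[rat]_(1 + d) -> Prop) (r : nat) : Prop :=
  (exists M : 'M[rat]_(r, 1 + d), (forall i, F (row i M)) /\ \rank M = r) /\
  (forall M : 'M[rat]_(r.+1, 1 + d), (forall i, F (row i M)) -> (\rank M < r.+1)%N).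
Definition umbrella A L f eps (tau : {set 'I_n}) : Prop :=
  exists F, [/\ is_face (DeltaAL A L f eps) F, ~ F (pt0 f eps) &
             forall j, j \in tau <-> F (ptL A L f eps j)].
(* tau in Phi_A^{L,k-1}: moreover the face has dimension k - 1 *)
Definition umbrella_rk A L f eps (k : nat) (tau : {set 'I_n}) : Prop :=
  exists F, [/\ is_face (DeltaAL A L f eps) F, ~ F (pt0 f eps),
             (forall j, j \in tau <-> F (ptL A L f eps j)) & maxrank F k].

End Defs.

(* Main.v *)
(* Homogenising by [(1, 0)], a face of the [(A, L)]-polyhedron away from the origin is the
   equality set [tau] of a system [h . a_j <= L_j].  For such an [h] every monomial of degree
   [b] has weight at least [h . b], with equality exactly when its support lies in [tau];
   hence initial forms of [I_A] lie in [I_A^tau], the vanishing ideal of the orbit of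
   [1_tau].  Conversely, for a prime [P] containing [gr^L I_A], the set [tau] of the [j]
   with [d_j] outside [P] has such an [h]: otherwise Motzkin's transposition theorem yields
   [u] in the kernel of [A] for which the initial form of a binomial of [I_A] forces [P] to
   contain a monomial supported on [tau].  When [P] is graded, it is determined modulo the
   [d_j] off [tau] by the binomials of weight zero, so [P = I_A^tau]; when [P] is the ideal
   of a point [xi], those binomials say that [xi] defines a character of [Z tau], which
   extends to [Z^d].  Finally every face lies in one of full rank (move [h] until enough
   inequalities become tight), and one-parameter subgroups degenerate the larger orbit to
   the smaller one. *)
Require Import Defs.
From mathcomp Require Import all_boot all_order all_algebra.
From mathcomp Require Import boolp reals.
From mathcomp.real_closed Require Import complex.
From mathcomp Require Import mpoly.
From mathcomp Require Import ring zify.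

Set Implicit Arguments.
Unset Strict Implicit.
Unset Printing Implicit Defensive.

Import Order.TTheory GRing.Theory Num.Theory.
Local Open Scope ring_scope.

(** * Dot products of row vectors and Farkas' lemma *)

Definition dotp {F : pzRingType} {k : nat} (a x : 'rV[F]_k) : F :=
  \sum_i a ord0 i * x ord0 i.

Lemma dotpDl (F : pzRingType) k (a b x : 'rV[F]_k) :
  dotp (a + b) x = dotp a x + dotp b x.
Proof. by rewrite -big_split; apply: eq_bigr => i _; rewrite mxE mulrDl. Qed.

Lemma dotpZl (F : pzRingType) k c (a x : 'rV[F]_k) :
  dotp (c *: a) x = c * dotp a x.
Proof. by rewrite mulr_sumr; apply: eq_bigr => i _; rewrite mxE mulrA. Qed.

Lemma dotpC (F : comPzRingType) k (a x : 'rV[F]_k) : dotp a x = dotp x a.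
Proof. by apply: eq_bigr => i _; rewrite mulrC. Qed.

Lemma dotpDr (F : comPzRingType) k (a x y : 'rV[F]_k) :
  dotp a (x + y) = dotp a x + dotp a y.
Proof. by rewrite dotpC dotpDl !(dotpC a). Qed.

Lemma dotpZr (F : comPzRingType) k c (a x : 'rV[F]_k) :
  dotp a (c *: x) = c * dotp a x.
Proof. by rewrite dotpC dotpZl dotpC. Qed.

Lemma dotpNl (F : pzRingType) k (a x : 'rV[F]_k) : dotp (- a) x = - dotp a x.
Proof. by rewrite -scaleN1r dotpZl mulN1r. Qed.

Lemma dotpNr (F : comPzRingType) k (a x : 'rV[F]_k) : dotp a (- x) = - dotp a x.
Proof. by rewrite dotpC dotpNl dotpC. Qed.

Lemma dotp0r (F : comPzRingType) k (a : 'rV[F]_k) : dotp a 0 = 0.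
Proof. by rewrite /dotp big1 // => i _; rewrite mxE mulr0. Qed.

Lemma dotp_sumr (F : comPzRingType) k (I : Type) (s : seq I) (P : pred I)
    (a : 'rV[F]_k) (x : I -> 'rV[F]_k) :
  dotp a (\sum_(i <- s | P i) x i) = \sum_(i <- s | P i) dotp a (x i).
Proof. by elim/big_rec2: _ => [|i y z _ <-]; rewrite ?dotp0r ?dotpDr. Qed.

Lemma dotp_row (F : pzRingType) k l (a c : 'rV[F]_k) (b e : 'rV[F]_l) :
  dotp (row_mx a b) (row_mx c e) = dotp a c + dotp b e.
Proof.
rewrite /dotp big_split_ord /=.
by congr (_ + _); apply: eq_bigr => i _; rewrite ?row_mxEl ?row_mxEr.
Qed.

Lemma dotp_scalar (F : pzRingType) (a b : F) : dotp (a%:M : 'M_1) b%:M = a * b.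
Proof. by rewrite /dotp big_ord1 !mxE. Qed.

(* Bartl's induction on the number of inequalities: if the first ones alone do not
   imply the conclusion, project along a witness [x0] of that failure. *)
Lemma farkas_seq (F : realFieldType) k (I : eqType) (s : seq I) : uniq s ->
  forall (v : I -> 'rV[F]_k) (g : 'rV[F]_k),
  (exists x, (forall i, i \in s -> dotp (v i) x <= 0) /\ 0 < dotp g x) \/
  (exists c : I -> F, (forall i, 0 <= c i) /\ g = \sum_(i <- s) c i *: v i).
Proof.
elim: s => [_ v g|i s IH /= /andP[i_s us] v g].
  have [->|g0] := eqVneq g 0; first by right; exists (fun _ => 0); rewrite big_nil.
  left; exists g; split=> //; rewrite /dotp lt_neqAle sumr_ge0 ?andbT; last first.
    by move=> i _; rewrite -expr2 sqr_ge0.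
  apply: contra_neq g0 => /esym/psumr_eq0P h; apply/rowP=> i; rewrite mxE.
  have /eqP := h (fun j _ => ltac:(by rewrite -expr2 sqr_ge0)) i isT.
  by rewrite -expr2 sqrf_eq0 => /eqP.
have [[x0 [sx0 gx0]]|[c [c0 ->]]] := IH us v g; last first.
  right; exists (fun j => if j == i then 0 else c j); split=> [j|]; first by case: ifP.
  rewrite big_cons eqxx scale0r add0r; apply: eq_big_seq => j js.
  by case: eqP => // e; rewrite -e js in i_s.
have [vi|vi] := lerP (dotp (v i) x0) 0.
  by left; exists x0; split=> // j; rewrite inE => /orP[/eqP->|/sx0].
wlog vi1 : x0 sx0 gx0 vi / dotp (v i) x0 = 1.
  move=> /(_ ((dotp (v i) x0)^-1 *: x0)); apply; rewrite ?dotpZr.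
  - by move=> j js; rewrite dotpZr pmulr_rle0 ?invr_gt0 ?sx0.
  - by rewrite mulr_gt0 ?invr_gt0.
  - by rewrite mulVf ?lt0r_neq0.
  - by rewrite mulVf ?lt0r_neq0.
have [[x [sx gx]]|[c [c0 e]]] :=
  IH us (fun j => v j - dotp (v j) x0 *: v i) (g - dotp g x0 *: v i).
  left; exists (x - dotp (v i) x *: x0); split=> [j|].
    rewrite inE dotpDr dotpNr dotpZr => /orP[/eqP->|js]; first by rewrite vi1 mulr1 subrr.
    by have := sx j js; rewrite dotpDl dotpNl dotpZl [_ * dotp _ _]mulrC.
  by move: gx; rewrite dotpDl dotpNl dotpZl dotpDr dotpNr dotpZr [_ * dotp _ x0]mulrC.
(* Undoing the projection gives [v i] the coefficient [dotp g x0 - S], nonnegative because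
   [dotp g x0 > 0] and [S <= 0]. *)
pose S := \sum_(j <- s) c j * dotp (v j) x0.
right; exists (fun j => if j == i then dotp g x0 - S else c j); split=> [j|].
  case: ifP => // _; rewrite subr_ge0 (le_trans _ (ltW gx0)) //.
  by rewrite /S big_seq sumr_le0 // => l ls; rewrite mulr_ge0_le0 ?sx0.
rewrite big_cons eqxx -[LHS](subrK (dotp g x0 *: v i)) e.
have -> : \sum_(j <- s) c j *: (v j - dotp (v j) x0 *: v i)
    = \sum_(j <- s) c j *: v j - S *: v i.
  rewrite scaler_suml -sumrB; apply: eq_bigr => j _.
  by rewrite scalerBr scalerA.
have -> : \sum_(j <- s) (if j == i then dotp g x0 - S else c j) *: v j
    = \sum_(j <- s) c j *: v j.
  apply: eq_big_seq => j js.
  by case: eqP => // ej; rewrite -ej js in i_s.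
by rewrite scalerBl -addrA addrC [_ - _]addrC.
Qed.

Lemma farkas (F : realFieldType) k (I : finType) (v : I -> 'rV[F]_k) (g : 'rV[F]_k) :
  (exists x, (forall i, dotp (v i) x <= 0) /\ 0 < dotp g x) \/
  (exists c : I -> F, (forall i, 0 <= c i) /\ g = \sum_i c i *: v i).
Proof.
have [[x [sx gx]]|[c [c0 e]]] := farkas_seq (enum_uniq I) v g.
  by left; exists x; split=> // i; rewrite sx // mem_enum.
by right; exists c; split=> //; rewrite e big_enum.
Qed.

Lemma clear_denominators n (u : 'I_n -> rat) :
  exists (N : int) (z : 'I_n -> int), 0 < N /\ forall j, (z j)%:~R = N%:~R * u j.
Proof.
exists (\prod_j denq (u j)), (fun j => numq (u j) * \prod_(i | i != j) denq (u i)).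
split=> [|j]; first by apply: prodr_gt0 => j _; apply: denq_gt0.
rewrite [in RHS](bigD1 j) //= !intrM -{3}[u j]divq_num_den; set Q := (\prod_(_ | _) _)%:~R.
by field; rewrite intr_eq0 denq_eq0.
Qed.

(** * Supporting functionals and a theorem of the alternative *)

Definition colq {d n : nat} (A : 'M[int]_(d, n)) (j : 'I_n) : 'rV[rat]_d :=
  \row_i (A i j)%:~R.

(** The condition [h . a_j = L_j] is [h . (a_j / L_j) = 1] freed of the division, so that zero and
    negative [L_j] are covered. *)
Definition supports {d n : nat} (A : 'M[int]_(d, n)) (L : 'I_n -> rat)
    (tau : {set 'I_n}) (h : 'rV[rat]_d) : Prop :=
  forall j, dotp h (colq A j) <= L j /\ (j \in tau) = (dotp h (colq A j) == L j).

Definition Ldot {n : nat} (L : 'I_n -> rat) (u : 'cV[int]_n) : rat :=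
  \sum_j L j * (u j ord0)%:~R.

(* Motzkin's transposition theorem for the system [h . a_j = L_j (j in tau)],
   [h . a_j < L_j (j notin tau)], homogenised by the extra generator [(1, 0)]. *)
Lemma supports_alternative d n (A : 'M[int]_(d, n)) (L : 'I_n -> rat) (tau : {set 'I_n}) :
  (exists h, supports A L tau h) \/
  (exists u : 'cV[int]_n,
     [/\ A *m u = 0, forall j, j \notin tau -> 0 <= u j ord0, Ldot L u <= 0 &
         Ldot L u < 0 \/ exists2 j, j \notin tau & 0 < u j ord0]).
Proof.
pose pv j : 'rV[rat]_(1 + d) := row_mx (L j)%:M (colq A j).
pose v0 : 'rV[rat]_(1 + d) := row_mx 1%:M 0.
pose w t := if t is Some j then pv j else v0.
(* [v] lists the weak inequalities, with both signs of [pv j] for [j] in [tau] and 0 in the spare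
   slots; [strict] marks those [w t] whose inequality must be strict. *)
pose v (i : 'I_1 + 'I_n + 'I_n) :=
  match i with inl (inl _) => v0 | inl (inr j) => pv j | inr j => if j \in tau then - pv j else 0 end.
pose strict t := if t is Some j then j \notin tau else true.
have [noc|/existsNP[t /not_implyP[st /contrapT[c [c0 e]]]]] :=
  pselect (forall t, strict t -> ~ exists c : 'I_1 + 'I_n + 'I_n -> rat,
     (forall i, 0 <= c i) /\ - w t = \sum_i c i *: v i); last first.
  right.
  (* With all terms of the relation on one side, [u' j] is the total coefficient of [pv j]:
     nonnegative off [tau], and at least 1 at a strict column [t]. The coefficient of [v0] reappears
     as minus the [L]-weight. *)
  pose u' j := c (inl (inr j)) - (if j \in tau then c (inr j) else 0)
    + (t == Some j)%:R.
  have eu : \sum_j u' j *: pv j = - (c (inl (inl ord0)) + (t == None)%:R) *: v0.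
    have -> : \sum_j u' j *: pv j = \sum_j c (inl (inr j)) *: pv j
        + \sum_j c (inr j) *: v (inr j) + \sum_j (t == Some j)%:R *: pv j.
      rewrite -!big_split; apply: eq_bigr => j _ /=.
      rewrite !scalerDl; congr (_ + _ + _); case: ifP => _.
        by rewrite scaleNr scalerN.
      by rewrite oppr0 scale0r scaler0.
    have -> : \sum_j (t == Some j)%:R *: pv j = w t - (t == None)%:R *: v0.
      case: (t) => [k|] /=; last first.
        by rewrite scale1r subrr big1 // => j _; rewrite scale0r.
      rewrite (bigD1 k) //= eqxx scale1r scale0r subr0 big1 ?addr0 // => j jk.
      by rewrite (inj_eq Some_inj) eq_sym (negPf jk) scale0r.
    have := e; rewrite !big_sumType big_ord1 /= => e'.
    move: e'; set S1 := \sum_j _; set S2 := \sum_j _.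
    move: S1 S2 => S1 S2 e'; rewrite -[w t]opprK e'.
    by apply/rowP=> i; rewrite !mxE; ring.
  have u'0 j : j \notin tau -> (t == Some j)%:R <= u' j.
    by move=> jt; rewrite /u' (negPf jt) subr0 lerDr.
  have uA : \sum_j u' j *: colq A j = 0.
    apply/rowP=> i; have /rowP/(_ (rshift 1 i)) := eu.
    rewrite summxE [RHS]mxE row_mxEr mxE mulr0 => <-.
    rewrite summxE; apply: eq_bigr => j _.
    by rewrite [RHS]mxE row_mxEr mxE.
  have uL : \sum_j L j * u' j = - (c (inl (inl ord0)) + (t == None)%:R).
    have /rowP/(_ (lshift d 0)) := eu.
    rewrite summxE [RHS]mxE row_mxEl mxE mulr1 => <-.
    by apply: eq_bigr => j _; rewrite mxE row_mxEl mxE mulrC.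
  have [N [z [N0 zE]]] := clear_denominators u'.
  have z_ge j (b : bool) : b%:R <= u' j -> if b then 0 < z j else 0 <= z j.
    case: b => /= h; rewrite -(ltr0z rat, ler0z rat) zE.
      by rewrite mulr_gt0 ?ltr0z // (lt_le_trans ltr01).
    by rewrite mulr_ge0 // ler0z ltW.
  have LzE : Ldot L (\col_j z j) = N%:~R * - (c (inl (inl ord0)) + (t == None)%:R).
    rewrite -uL mulr_sumr; apply: eq_bigr => j _.
    by rewrite mxE zE mulrCA.
  have N0' : 0 < N%:~R :> rat by rewrite ltr0z.
  have Lz_le : Ldot L (\col_j z j) <= 0.
    by rewrite LzE pmulr_rle0 // oppr_le0 addr_ge0.
  exists (\col_j z j); split=> //.
  - apply/colP=> i; have /rowP/(_ i) := uA; rewrite !mxE summxE => uAi.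
    apply/eqP; rewrite -(intr_eq0 rat) rmorph_sum /=; apply/eqP.
    transitivity (N%:~R * \sum_j (u' j *: colq A j) ord0 i); last by rewrite uAi mulr0.
    rewrite mulr_sumr; apply: eq_bigr => j _.
    by rewrite !mxE intrM zE; ring.
  - by move=> j /u'0/z_ge; rewrite mxE; case: ifP => // _ /ltW.
  - have [tN|[k [tk kt]]] : t = None \/ exists k, t = Some k /\ k \notin tau.
      by case: (t) st => [k|]; [right; exists k|left].
      by left; rewrite LzE tN eqxx pmulr_rlt0 // oppr_lt0 ltr_wpDl.
    right; exists k => //; rewrite mxE; apply: (z_ge k true).
    by have := u'0 k kt; rewrite tk eqxx.
left.
(* Farkas' lemma makes one strict inequality hold at a time; the sum of the solutions makes all of
   them strict at once. *)
have /choice[x xP] : forall t, exists x,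
    (forall i, dotp (v i) x <= 0) /\ (strict t -> dotp (w t) x < 0).
  move=> t; case: (boolP (strict t)) => [st|_]; last first.
    by exists 0; split=> // i; rewrite dotp0r.
  have [[x [sx gx]]|cx] := farkas v (- w t); last by case: (noc t st).
  by exists x; split=> // _; rewrite -oppr_gt0 -dotpNl.
pose X := \sum_t x t.
have vX i : dotp (v i) X <= 0 by rewrite dotp_sumr sumr_le0 // => t _; case: (xP t).
have wX t : strict t -> dotp (w t) X < 0.
  move=> st; rewrite dotp_sumr (bigD1 t) //= ltr_nwDl //; first by case: (xP t) => _ ->.
  apply: sumr_le0 => t' _; case: (xP t') => h _.
  by case: (t) => [j|]; [apply: (h (inl (inr j)))|apply: (h (inl (inl ord0)))].
pose X0 := lsubmx X ord0 ord0; pose X1 := rsubmx X.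
have XE : X = row_mx X0%:M X1 by rewrite -[LHS]hsubmxK [lsubmx X]mx11_scalar.
have pvX j : dotp (pv j) X = L j * X0 + dotp X1 (colq A j).
  by rewrite XE dotp_row dotp_scalar [dotp (colq _ _) _]dotpC.
have X0lt : X0 < 0.
  by have := wX None isT; rewrite XE dotp_row dotp_scalar mul1r dotpC dotp0r addr0.
exists ((- X0)^-1 *: X1) => j; rewrite dotpZl mulrC.
have X0' : 0 < - X0 by rewrite oppr_gt0.
have h1 : dotp (pv j) X <= 0 := vX (inl (inr j)).
split; first by rewrite ler_pdivrMr // mulrN -subr_le0 opprK addrC -pvX.
rewrite eq_sym -subr_eq0 -[L j](mulfK (lt0r_neq0 X0')) -mulrBl mulf_eq0 invr_eq0.
rewrite (gt_eqF X0') orbF mulrN -opprD oppr_eq0 -pvX.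
have [jt|jt] := boolP (j \in tau); apply/esym; last exact: lt_eqF (wX (Some j) jt).
have := vX (inr j); rewrite /= jt dotpNl oppr_le0 => h2.
by apply/eqP/le_anti; rewrite h1.
Qed.

(** * The polyhedron in its affine chart and its faces away from the origin *)

Section Chart.
Variables (d n : nat) (A : 'M[int]_(d, n)) (L : 'I_n -> rat).
Variables (f : 'I_d -> int) (eps : rat).
Hypothesis eps_gt0 : 0 < eps.
Hypothesis f_gt : forall j, 0 < lform f A j /\ eps * `|L j| < (lform f A j)%:~R.

(** The value at [(L_j, a_j)] of the form defining the chart. The bound on [eps] makes it positive,
    so passing to the chart preserves signs. *)
Let den j := (lform f A j)%:~R + eps * L j.

Let den_gt0 j : 0 < den j.
Proof.
have [_ h] := f_gt j; rewrite /den -ltrBlDr sub0r -mulrN.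
by apply: le_lt_trans h; rewrite ler_wpM2l ?(ltW eps_gt0) // -normrN ler_norm.
Qed.

Lemma pt0E : pt0 f eps = eps^-1 *: row_mx 1%:M 0.
Proof.
by rewrite /pt0 /chartpt big1 ?add0r ?mulr1 // => i _; rewrite mxE mulr0.
Qed.

Lemma ptLE j : ptL A L f eps j = (den j)^-1 *: row_mx (L j)%:M (colq A j).
Proof.
rewrite /ptL /chartpt /den; congr (_^-1 *: _); congr (_ + _).
by rewrite rmorph_sum; apply: eq_bigr => i _; rewrite mxE -intrM.
Qed.

Lemma Delta_pt0 : DeltaAL A L f eps (pt0 f eps).
Proof.
exists 1, (fun _ => 0); split=> //; first by rewrite big1 ?addr0.
by rewrite scale1r big1 ?addr0 // => j _; rewrite scale0r.
Qed.

Lemma Delta_ptL j : DeltaAL A L f eps (ptL A L f eps j).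
Proof.
exists 0, (fun k => (k == j)%:R); split=> //.
  by rewrite add0r (bigD1 j) //= eqxx big1 ?addr0 // => k /negPf->.
rewrite scale0r add0r (bigD1 j) //= eqxx scale1r big1 ?addr0 // => k /negPf->.
by rewrite scale0r.
Qed.

(** Up to positive factors, [psi] takes the value -1 at the origin of the polyhedron and
    [h . a_j - L_j] at the point of column [j]. *)
Lemma supports_face tau h : supports A L tau h ->
  let psi : 'rV[rat]_(1 + d) := row_mx (-1)%:M h in
  let F v := DeltaAL A L f eps v /\ dotp psi v = 0 in
  [/\ is_face (DeltaAL A L f eps) F, ~ F (pt0 f eps) &
      forall j, j \in tau <-> F (ptL A L f eps j)].
Proof.
move=> hP psi F.
have psi0 : dotp psi (pt0 f eps) < 0.
  rewrite pt0E dotpZr dotp_row dotp_scalar dotp0r mulr1 addr0 mulrN1 oppr_lt0.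
  by rewrite invr_gt0.
have psij j : dotp psi (ptL A L f eps j) = (den j)^-1 * (dotp h (colq A j) - L j).
  by rewrite ptLE dotpZr dotp_row dotp_scalar mulN1r addrC.
split.
- exists psi, 0; split=> v; rewrite addr0 // => -[c0 [c [c0_ge0 c_ge0 _ ->]]].
  rewrite -/(dotp psi _) dotpDr dotpZr dotp_sumr -[leRHS]addr0 lerD //.
    by rewrite mulr_ge0_le0 // ltW.
  apply: sumr_le0 => j _; rewrite dotpZr mulr_ge0_le0 // psij.
  by rewrite pmulr_rle0 ?invr_gt0 // subr_le0; case: (hP j).
- by case=> _ e; rewrite e ltxx in psi0.
- move=> j; case: (hP j) => _ ->; split=> [/eqP e|[_ /eqP]].
    by split; [exact: Delta_ptL|rewrite psij e subrr mulr0].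
  by rewrite psij mulf_eq0 invr_eq0 (gt_eqF (den_gt0 j)) subr_eq0.
Qed.

(* Homogenising the supporting functional [psi + c] by the equation [f(x) + eps x0 = 1]
   of the chart gives [phi = phi0 (1, -h)] with [phi0 < 0]. *)
Lemma umbrellaP tau : umbrella A L f eps tau <-> exists h, supports A L tau h.
Proof.
split=> [[F [[psi [c [psi_le FE]]] F0 Ftau]]|[h /supports_face[? ? ?]]]; last first.
  by eexists; split; eassumption.
pose phi := psi + c *: row_mx eps%:M (\row_i (f i)%:~R).
pose phi0 := lsubmx phi ord0 ord0; pose phi1 := rsubmx phi.
have phiE x0 x : dotp phi (row_mx x0%:M x) = phi0 * x0 + dotp phi1 x.
  by rewrite -[phi]hsubmxK [lsubmx phi]mx11_scalar dotp_row dotp_scalar.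
have psi0 : dotp psi (pt0 f eps) + c = eps^-1 * phi0.
  have -> : phi0 = dotp phi (row_mx 1%:M 0) by rewrite phiE dotp0r mulr1 addr0.
  rewrite pt0E dotpZr dotpDl dotpZl dotp_row dotp_scalar dotp0r mulr1 addr0 mulrDr.
  by congr (_ + _); field; rewrite gt_eqF.
have psij j : dotp psi (ptL A L f eps j) + c = (den j)^-1 * (phi0 * L j + dotp phi1 (colq A j)).
  rewrite -phiE ptLE dotpZr dotpDl dotpZl dotp_row dotp_scalar mulrDr.
  have -> : dotp (\row_i (f i)%:~R) (colq A j) = (lform f A j)%:~R.
    by rewrite rmorph_sum; apply: eq_bigr => i _; rewrite !mxE -intrM.
  congr (_ + _); rewrite [eps * _ + _]addrC -/(den j) mulrCA mulVf ?mulr1 //.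
  by rewrite gt_eqF.
have phi0_lt : phi0 < 0.
  rewrite -(pmulr_rlt0 _ (x := eps^-1)) ?invr_gt0 // -psi0 lt_neqAle.
  rewrite (psi_le _ Delta_pt0) andbT; apply/eqP => e.
  by apply: F0; apply/FE; split=> //; exact: Delta_pt0.
have phi0_lt' : 0 < - phi0 by rewrite oppr_gt0.
exists ((- phi0)^-1 *: phi1) => j; rewrite dotpZl mulrC.
have le_j : phi0 * L j + dotp phi1 (colq A j) <= 0.
  rewrite -(pmulr_rle0 _ (x := (den j)^-1)) ?invr_gt0 // -psij.
  exact/psi_le/Delta_ptL.
split; first by rewrite ler_pdivrMr // mulrN -subr_le0 opprK addrC mulrC.
rewrite -subr_eq0 -[L j](mulfK (lt0r_neq0 phi0_lt')) -mulrBl mulf_eq0 invr_eq0.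
rewrite (gt_eqF phi0_lt') orbF mulrN opprK [L j * _]mulrC addrC.
have -> : (phi0 * L j + dotp phi1 (colq A j) == 0)
    = (dotp psi (ptL A L f eps j) + c == 0).
  by rewrite psij mulf_eq0 invr_eq0 (gt_eqF (den_gt0 j)).
apply/idP/eqP => [/Ftau/FE[]//|e].
by apply/Ftau/FE; split=> //; exact: Delta_ptL.
Qed.

(** Zeroing the rows off [tau] keeps ['I_n] as index type; [row_full] then says that the columns in
    [tau] span [Q^d]. *)
Definition masked (tau : {set 'I_n}) : 'M[rat]_(n, d) :=
  \matrix_(j, i) ((j \in tau)%:R * colq A j ord0 i).

(** [tau] supplies [d] independent points, while [(-1, h)] annihilates the whole face and so rules
    out [d + 1] of them. *)
Lemma supports_umbrella_rk tau h :
  supports A L tau h -> row_full (masked tau) -> umbrella_rk A L f eps d tau.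
Proof.
move=> hP full_tau; have [faceF F0 Ftau] := supports_face hP.
set F := fun v => _ in faceF F0 Ftau; exists F; split=> //; split=> [|M FM].
  have := fullrowsub_unit full_tau; set B := rowsub _ _ => uB.
  have g_in i : fullrankfun full_tau i \in tau.
    apply/negPn/negP => /negPf gi; have /row_freeP[B' BB'] : row_free B.
      by rewrite row_free_unit.
    have /matrixP/(_ i i)/eqP := BB'; rewrite !mxE eqxx big1 ?(eq_sym 0) ?oner_eq0 //.
    by move=> k _; rewrite !mxE gi !mul0r.
  pose g := fullrankfun full_tau.
  pose M := \matrix_(i < d) ptL A L f eps (g i); exists M; split=> [i|].
    by rewrite rowK; apply/Ftau.
  apply/eqP; rewrite -/(row_free M) -row_leq_rank.
  (* The last [d] coordinates suffice: they form the invertible [B] with rows rescaled by the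
     inverses of [den]. *)
  suff rd : \rank (rsubmx M) = d.
    rewrite -[X in (X <= _)%N]rd.
    have -> : rsubmx M = M *m col_mx 0 1%:M.
      by rewrite -[in RHS](hsubmxK M) mul_row_col mulmx0 add0r mulmx1.
    exact: mxrankM_maxl.
  have -> : rsubmx M = diag_mx (\row_i (den (g i))^-1) *m B.
    apply/matrixP=> i k; rewrite mul_diag_mx [LHS]mxE [M _ _]mxE ptLE [LHS]mxE row_mxEr.
    by rewrite !mxE g_in mul1r.
  apply: mxrank_unit; rewrite unitmx_mul uB andbT unitmxE det_diag unitfE.
  by apply/prodf_neq0 => i _; rewrite mxE invr_eq0 gt_eqF.
rewrite ltn_neqAle rank_leq_row andbT; apply/negP => /eqP rM.
have fM : row_full M by rewrite /row_full rM.
have /row_fullP[M' M'M] := fM.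
have : M *m (row_mx (-1)%:M h)^T = 0.
  apply/colP=> i; have [_ e] := FM i; rewrite !mxE -[RHS]e.
  by apply: eq_bigr => k _; rewrite !mxE mulrC.
move=> /(congr1 (mulmx M')); rewrite mulmxA M'M mul1mx mulmx0.
move=> /matrixP/(_ (lshift d 0) 0)/eqP.
by rewrite mxE row_mxEl !mxE eqxx oppr_eq0 oner_eq0.
Qed.
End Chart.

(** * Enlarging faces and choosing integral weights *)

Lemma colqE d n (A : 'M[int]_(d, n)) j i : colq A j ord0 i = (A i j)%:~R.
Proof. by rewrite mxE. Qed.

(** Fullness writes each unit vector as an integral combination of the columns. *)
Lemma full_separates d n (A : 'M[int]_(d, n)) (v : 'rV[rat]_d) :
  full A -> (forall j, dotp v (colq A j) = 0) -> v = 0.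
Proof.
move=> fullA v0; apply/rowP=> i; have [u Au] := fullA (delta_mx i 0).
have : \sum_j dotp v (colq A j) * (u j 0)%:~R = 0.
  by rewrite big1 // => j _; rewrite v0 mul0r.
under eq_bigr do rewrite mulr_suml.
rewrite exchange_big /= (bigD1 i) //= [X in _ + X]big1 => [|k ki].

  under eq_bigr do rewrite colqE -mulrA -intrM.
  rewrite -mulr_sumr -rmorph_sum /=; have /colP/(_ i) := Au; rewrite !mxE => ->.
  by rewrite !eqxx mulr1 addr0.
under eq_bigr do rewrite colqE -mulrA -intrM.
rewrite -mulr_sumr -rmorph_sum /=; have /colP/(_ k) := Au; rewrite !mxE => ->.
by rewrite (negPf ki) mulr0.
Qed.

(** Induction on the number of columns off [tau]. If [tau] does not span, some [v != 0] vanishes on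
    it, and moving [h] along [v] keeps the equalities on [tau] until a new inequality becomes
    tight. *)
Lemma supports_extend d n (A : 'M[int]_(d, n)) (L : 'I_n -> rat) :
  full A -> forall tau h, supports A L tau h -> exists sigma h',
  [/\ supports A L sigma h', tau \subset sigma & row_full (masked A sigma)].
Proof.
move=> fullA tau; have [m] := ubnP #|~: tau|.
elim: m tau => // m IH tau; rewrite ltnS => tau_m h hP.
have [full_tau|nfull_tau] := boolP (row_full (masked A tau)); first by exists tau, h.
have [v v0 vtau] : exists2 v : 'rV[rat]_d, v != 0 &
    forall j, j \in tau -> dotp v (colq A j) = 0.
  have /matrix0Pn[i [k ik]] : cokermx (masked A tau) != 0.
    by rewrite -mxrank_eq0 mxrank_coker subn_eq0 -ltnNge ltn_neqAle rank_leq_col andbT.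
  exists (row k (cokermx (masked A tau))^T).
    by apply: contraNneq ik => /rowP/(_ i); rewrite !mxE => ->.
  move=> j jt; have /matrixP/(_ j k) := mulmx_coker (masked A tau).
  rewrite !mxE => e; rewrite dotpC -[RHS]e; apply: eq_bigr => l _.
  by rewrite !mxE jt mul1r.
(* By fullness [v] is nonzero on some column; up to replacing [v] by [- v], it is positive there. *)
wlog [j0 vj0] : v v0 vtau / exists j, 0 < dotp v (colq A j).
  move=> wl; have [|/existsNP[j /eqP vj]] :=
    pselect (forall j, dotp v (colq A j) = 0).
    by move=> /(full_separates fullA) ve; rewrite ve eqxx in v0.
  have [vj_gt|vj_lt|vj_eq] := ltrgtP 0 (dotp v (colq A j)).
  - by apply: (wl v) => //; exists j.
  - apply: (wl (- v)); rewrite ?oppr_eq0 //; last by exists j; rewrite dotpNl oppr_gt0.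
    by move=> l /vtau e; rewrite dotpNl e oppr0.
  - by rewrite -vj_eq eqxx in vj.
(* [q j] is the step length at which inequality [j] becomes tight; only columns with [v . a_j > 0]
   limit the motion. *)
pose q j := (L j - dotp h (colq A j)) / dotp v (colq A j).
pose js := [arg min_(j < j0 | 0 < dotp v (colq A j)) q j]%O.
have [vjs q_min] : 0 < dotp v (colq A js) /\
    forall j, 0 < dotp v (colq A j) -> q js <= q j.
  by rewrite /js; case: arg_minP.
have q_ge0 : 0 <= q js by rewrite divr_ge0 ?(ltW vjs) // subr_ge0; case: (hP js).
pose h' := h + q js *: v.
pose tau' := [set j | dotp h' (colq A j) == L j].
have h'P : supports A L tau' h'.
  move=> j; split; last by rewrite inE.
  rewrite dotpDl dotpZl; have [vj|vj] := ltP 0 (dotp v (colq A j)).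
    by rewrite addrC -lerBrDr -ler_pdivlMr ?q_min.
  rewrite -[leRHS]addr0 lerD //; first by case: (hP j).
  by rewrite mulr_ge0_le0.
have sub : tau \subset tau'.
  apply/subsetP=> j jt; rewrite inE dotpDl dotpZl vtau // mulr0 addr0.
  by case: (hP j) => _ <-.
have js' : js \in tau'.
  by rewrite inE dotpDl dotpZl /q divfK ?lt0r_neq0 // subrKC.
have jsN : js \notin tau by apply/negP=> /vtau e; rewrite e ltxx in vjs.
have tau'_m : (#|~: tau'| < m)%N.
  apply: leq_trans tau_m; apply: proper_card; apply/properP; split.
    by rewrite setCS.
  by exists js; rewrite inE ?jsN // js'.
have [sigma [h'' [? sub' ?]]] := IH tau' tau'_m h' h'P.
by exists sigma, h''; split=> //; exact: subset_trans sub'.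
Qed.

(** [h' - h], cleared of denominators, is a positive multiple of [L_j - h . a_j] on [sigma]. It is
    the one-parameter subgroup that degenerates the orbit of [sigma] to that of [tau]. *)
Lemma supports_weight d n (A : 'M[int]_(d, n)) (L : 'I_n -> rat) tau sigma h h' :
  supports A L tau h -> supports A L sigma h' -> tau \subset sigma ->
  exists w : 'I_d -> int, forall j, j \in sigma ->
    0 <= lform w A j /\ (lform w A j == 0) = (j \in tau).
Proof.
move=> hP h'P sub; have [N [w [N0 wE]]] := clear_denominators (fun i => (h' - h) ord0 i).
have N0' : 0 < N%:~R :> rat by rewrite ltr0z.
exists w => j js.
have wj : (lform w A j)%:~R = N%:~R * (L j - dotp h (colq A j)).
  have [_] := h'P j; rewrite js => /esym/eqP<-; rewrite -dotpNl -dotpDl mulr_sumr.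
  by rewrite rmorph_sum /=; apply: eq_bigr => i _; rewrite intrM wE !mxE mulrA.
have [le_j ->] := hP j; split.
  by rewrite -(ler0z rat) wj mulr_ge0 ?(ltW N0') // subr_ge0.
by rewrite -(intr_eq0 rat) wj mulf_eq0 (gt_eqF N0') subr_eq0 eq_sym.
Qed.

Definition wdot {d : nat} (w : 'I_d -> int) (b : 'cV[int]_d) : int :=
  \sum_i w i * b i ord0.

(** Induction on [B]: a weight that kills the new vector [b] is scaled up, then perturbed in a
    coordinate where [b] is nonzero. *)
Lemma generic_weight d n (A : 'M[int]_(d, n)) (B : seq 'cV[int]_d) :
  pointed A -> (forall b, b \in B -> b != 0) ->
  exists w, (forall j, 0 < lform w A j) /\ forall b, b \in B -> wdot w b != 0.
Proof.
move=> [f f_gt]; elim: B => [|b B IH] B0; first by exists f.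
have [|w [w_gt wB]] := IH; first by move=> c cB; rewrite B0 // inE cB orbT.
have [wb|wb] := eqVneq (wdot w b) 0; last first.
  by exists w; split=> // c; rewrite inE => /orP[/eqP->|/wB].
have /matrix0Pn[i [k bi]] : b != 0 by rewrite B0 ?mem_head.
rewrite ord1 in bi.
(* [K] exceeds the absolute [i]-th entry of every vector of [B] and of every column, so [K] times a
   nonzero integer outweighs the perturbation. *)
pose K : int := 1 + \sum_(c <- B) `|c i ord0| + \sum_j `|A i j|.
have sB (C : seq 'cV[int]_d) : 0 <= \sum_(c <- C) `|c i ord0| by apply: sumr_ge0.
have sA (P : pred 'I_n) : 0 <= \sum_(j | P j) `|A i j| by apply: sumr_ge0.
have KB c : c \in B -> `|c i ord0| < K.
  move=> cB; rewrite /K (perm_big _ (perm_to_rem cB)) big_cons.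
  have := sB (rem c B); have /= := sA xpredT; move: (\sum_(_ <- _) _) (\sum_j _); lia.
have KA j : `|A i j| < K.
  rewrite /K [X in _ < _ + X](bigD1 j) //=.
  have := sB B; have /= := sA (fun l => l != j).
  move: (\sum_(_ <- _) _) (\sum_(_ | _) _); lia.
move: K KB KA => K KB KA.
pose w' l := K * w l + (l == i)%:R.
have w'E c : wdot w' c = K * wdot w c + c i ord0.
  rewrite /wdot mulr_sumr (bigD1 i) // [in RHS](bigD1 i) //= /w' eqxx.
  rewrite mulrDl mul1r mulrA -!addrA; congr (_ + _); rewrite addrC; congr (_ + _).
  by apply: eq_bigr => l /negPf->; rewrite addr0 mulrA.
exists w'; split=> [j|c].
  have -> : lform w' A j = K * lform w A j + A i j.
    have := w'E (col j A); rewrite mxE /wdot.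
    by under eq_bigr do rewrite mxE; under [in RHS]eq_bigr do rewrite mxE.
  by have := KA j; have := w_gt j; nia.
rewrite inE w'E => /orP[/eqP->|cB]; first by rewrite wb mulr0 add0r.
move: (KB c cB) (wB c cB); move: (wdot w c) (c i ord0) => x y yK x0.
by have [x1|x1] : 1 <= x \/ x <= -1 by [lia]; nia.
Qed.

(** * Fibre sums, monomial curves and torus characters *)

Lemma sum_fibers (V : nmodType) (I J : eqType) (s : seq I) (P : pred I) (g : I -> J)
    (F : I -> V) :
  \sum_(i <- s | P i) F i =
  \sum_(b <- undup (map g s)) \sum_(i <- s | P i && (g i == b)) F i.
Proof.
rewrite (exchange_big_dep P) /= => [|b i _ /andP[]//].
rewrite big_seq_cond [RHS]big_seq_cond; apply: eq_bigr => i /andP[si Pi].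
rewrite -big_filter (eq_filter (a2 := pred1 (g i))) => [|b]; last by rewrite /= Pi eq_sym.
by rewrite filter_pred1_uniq ?undup_uniq ?mem_undup ?map_f // big_seq1.
Qed.

Lemma sum_fibers0 (K : pzRingType) (I J : eqType) (s : seq I) (P : pred I)
    (g : I -> J) (F : I -> K) (G : J -> K) :
  (forall b, \sum_(i <- s | P i && (g i == b)) F i = 0) ->
  \sum_(i <- s | P i) F i * G (g i) = 0.
Proof.
move=> F0; rewrite (sum_fibers _ _ g) big1 // => b _.
rewrite (eq_bigr (fun i => F i * G b)) => [|i /andP[_ /eqP->]//].
by rewrite -mulr_suml F0 mul0r.
Qed.

Lemma big_msupp n (K : nzRingType) (q : {mpoly K[n]}) (s : seq 'X_{1..n})
    (P : pred 'X_{1..n}) :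
  uniq s -> {subset msupp q <= s} ->
  \sum_(m <- msupp q | P m) q@_m = \sum_(m <- s | P m) q@_m.
Proof.
move=> us sub; rewrite [RHS](bigID (mem (msupp q))) /= [X in _ + X]big1 => [|m]; last first.
  by case/andP=> _ /memN_msupp_eq0.
rewrite addr0 -[LHS]big_filter -[RHS]big_filter; apply: perm_big; apply: uniq_perm.
- by rewrite filter_uniq ?msupp_uniq.
- by rewrite filter_uniq.
- move=> m; rewrite !mem_filter -andbA; congr (_ && _).
  by case mq: (m \in msupp q) => //; rewrite sub.
Qed.

Lemma poly_eq0_infinite (F : numFieldType) (Q : {poly F}) :
  (forall s, s != 0 -> Q.[s] = 0) -> Q = 0.
Proof.
move=> Q0; apply/eqP/negPn/negP => Qn0.
have := max_poly_roots Qn0 (rs := [seq i.+1%:R | i <- iota 0 (size Q)]).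
rewrite size_map size_iota ltnn => h; suff: false by []; apply: h.
  by apply/allP=> x /mapP[i _ ->]; apply/rootP/Q0; rewrite pnatr_eq0.
by rewrite map_inj_uniq ?iota_uniq // => i j /eqP; rewrite eqr_nat => /eqP[].
Qed.

(** The restriction of [p] to the curve [s |-> (c_j s^(k_j))]. Natural exponents allow [s = 0],
    where limits of one-parameter subgroups are read off. *)
Definition curve_poly n (K : comNzRingType) (c : 'I_n -> K) (k : 'I_n -> nat)
    (p : {mpoly K[n]}) : {poly K} :=
  \sum_(m <- msupp p) p@_m *: \prod_j (c j *: 'X^(k j)) ^+ m j.

Lemma horner_curve n (K : comNzRingType) (c : 'I_n -> K) k (p : {mpoly K[n]}) s :
  (curve_poly c k p).[s] = p.@[fun j => c j * s ^+ k j].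
Proof.
rewrite horner_sum mevalE; apply: eq_bigr => m _; rewrite hornerZ horner_prod.
by congr (_ * _); apply: eq_bigr => j _; rewrite horner_exp hornerZ hornerXn.
Qed.

Definition msub n (tau : {set 'I_n}) (m : 'X_{1..n}) : bool :=
  [forall j, (m j != 0%N) ==> (j \in tau)].

Lemma prod_ind (R : realType) n (tau : {set 'I_n}) (m : 'X_{1..n}) :
  \prod_j ind R tau j ^+ m j = (msub tau m)%:R.
Proof.
have [/forallP mt|] := boolP (msub tau m).
  apply: big1 => j _; have := mt j; rewrite /ind.
  by case: eqP => [->|_ /= ->]; rewrite ?expr0 ?expr1n.
rewrite negb_forall => /existsP[j]; rewrite negb_imply => /andP[mj jt].
by rewrite (bigD1 j) //= /ind (negPf jt) expr0n (negPf mj) mul0r.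
Qed.

Definition chi d (K : fieldType) (eta : 'I_d -> K) (b : 'cV[int]_d) : K :=
  \prod_i eta i ^ b i ord0.

Lemma prodfXz (K : fieldType) (x : K) (I : Type) (s : seq I) (P : pred I) (F : I -> int) :
  x != 0 -> \prod_(i <- s | P i) x ^ F i = x ^ (\sum_(i <- s | P i) F i).
Proof.
by move=> x0; elim/big_rec2: _ => [|i a _ _ ->]; rewrite ?expr0z // expfzDr.
Qed.

Lemma AdegE d n (A : 'M[int]_(d, n)) (m : 'X_{1..n}) i :
  Adeg A m i ord0 = \sum_j A i j * (m j)%:Z.
Proof. by rewrite mxE; apply: eq_bigr => j _; rewrite mxE. Qed.

Lemma chi_Adeg d n (A : 'M[int]_(d, n)) (K : fieldType) (eta : 'I_d -> K) (m : 'X_{1..n}) :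
  (forall i, eta i != 0) ->
  \prod_j (\prod_i eta i ^ A i j) ^+ m j = chi eta (Adeg A m).
Proof.
move=> eta0; under eq_bigr do rewrite -prodrXl.
rewrite exchange_big; apply: eq_bigr => i _; rewrite AdegE -prodfXz //.
by apply: eq_bigr => j _; rewrite exprnP exprz_exp.
Qed.

Lemma meval_torus (R : realType) d n (A : 'M[int]_(d, n)) (tau : {set 'I_n}) (eta : 'I_d -> complex R)
    (p : {mpoly (complex R)[n]}) : (forall i, eta i != 0) ->
  p.@[tact A eta (ind R tau)] =
  \sum_(m <- msupp p | msub tau m) p@_m * chi eta (Adeg A m).
Proof.
move=> eta0; rewrite mevalE [RHS]big_mkcond /=; apply: eq_bigr => m _.
rewrite /tact; under eq_bigr do rewrite exprMn; rewrite big_split /= prod_ind chi_Adeg //.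
by case: ifP; rewrite (mulr1, mulr0) ?mulr0.
Qed.

Lemma wdot_Adeg d n (A : 'M[int]_(d, n)) w (m : 'X_{1..n}) :
  wdot w (Adeg A m) = \sum_j lform w A j * (m j)%:Z.
Proof.
rewrite /wdot; under eq_bigr do rewrite AdegE mulr_sumr.
rewrite exchange_big; apply: eq_bigr => j _; rewrite mulr_suml.
by apply: eq_bigr => i _; rewrite mulrA.
Qed.

Lemma wdotB d (w : 'I_d -> int) b c : wdot w (b - c) = wdot w b - wdot w c.
Proof. by rewrite -sumrB; apply: eq_bigr => i _; rewrite !mxE mulrBr. Qed.

(** For [s != 0] the curve stays in the orbit of [tau]. Exponents are compared with [w] on [tau]
    only, since the other coordinates are 0. *)
Lemma horner_curve_torus (R : realType) d n (A : 'M[int]_(d, n)) (tau : {set 'I_n})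
    (eta : 'I_d -> complex R) (w : 'I_d -> int) (k : 'I_n -> nat)
    (p : {mpoly (complex R)[n]}) (s : complex R) :
  s != 0 -> (forall i, eta i != 0) -> (forall j, j \in tau -> lform w A j = (k j)%:Z) ->
  (curve_poly (tact A eta (ind R tau)) k p).[s] =
  p.@[tact A (fun i => eta i * s ^ w i) (ind R tau)].
Proof.
move=> s0 eta0 wk; rewrite horner_curve; apply: meval_eq => j.
rewrite /tact /ind; case: ifP => [jt|]; last by rewrite !mulr0 mul0r.
rewrite !mulr1; under [RHS]eq_bigr do rewrite expfzMl exprz_exp.
by rewrite big_split /= prodfXz // -/(lform w A j) wk.
Qed.

(** * [tau_ideal] as the vanishing ideal of a torus orbit, and its primality *)

Definition torus_vanish (R : realType) d n (A : 'M[int]_(d, n)) (tau : {set 'I_n})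
    (p : {mpoly (complex R)[n]}) : Prop :=
  forall eta, (forall i, eta i != 0) -> p.@[tact A eta (ind R tau)] = 0.

Lemma tau_ideal_torus_vanish (R : realType) d n (A : 'M[int]_(d, n)) (tau : {set 'I_n})
    (p : {mpoly (complex R)[n]}) : tau_ideal A tau p -> torus_vanish A tau p.
Proof.
move=> pt eta eta0; rewrite meval_torus //; apply: sum_fibers0 => b; rewrite -[RHS](pt b).
by apply: eq_bigl => m; rewrite andbC.
Qed.

(** As [w] separates the degrees occurring in [p], the sum over one such degree in [tau_ideal] is a
    single coefficient of the curve polynomial. *)
Lemma curve_poly_eq0 (R : realType) d n (A : 'M[int]_(d, n)) (tau : {set 'I_n}) w
    (p : {mpoly (complex R)[n]}) :
  (forall j, 0 < lform w A j) ->
  {in msupp p &, forall m m', Adeg A m != Adeg A m' ->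
     wdot w (Adeg A m - Adeg A m') != 0} ->
  curve_poly (ind R tau) (fun j => absz (lform w A j)) p = 0 -> tau_ideal A tau p.
Proof.
move=> w_gt w_sep p0 b; set k := fun j => _ in p0.
have [/hasP[m0 m0p /eqP <-]|/hasPn nob] := boolP (has (fun m => Adeg A m == b) (msupp p));
    last first.
  by rewrite big_seq_cond big1 // => m /andP[/nob/negPf->].
pose deg (m : 'X_{1..n}) := (\sum_j k j * m j)%N.
have degE m : (deg m)%:Z = wdot w (Adeg A m).
  rewrite wdot_Adeg /deg (big_morph Posz PoszD (erefl (0 : int))); apply: eq_bigr => j _.
  by rewrite PoszM /k gtz0_abs.
have := congr1 (fun Q : {poly _} => Q`_(deg m0)) p0.
rewrite coef0 coef_sum => e; rewrite -[RHS]e big_mkcond big_seq [RHS]big_seq.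
apply: eq_bigr => m mp; rewrite coefZ.
have -> : \prod_j (ind R tau j *: 'X^(k j)) ^+ m j = (msub tau m)%:R *: 'X^(deg m).
  under eq_bigr do rewrite exprZn -exprM.
  by rewrite scaler_prod prod_ind prodrXr.
rewrite coefZ coefXn.
have -> : (Adeg A m == Adeg A m0) = (deg m0 == deg m).
  apply/eqP/eqP => [h|h]; first by apply/eqP; rewrite -eqz_nat !degE h.
  apply/eqP/negPn/negP => /(w_sep _ _ mp m0p); rewrite wdotB -!degE h.
  by rewrite subrr eqxx.
by rewrite -/(msub tau m); case: eqP; case: (msub _ _); rewrite ?(mulr0, mul0r, mulr1, mul1r).
Qed.

Lemma generic_weight_msupp (R : realType) d n (A : 'M[int]_(d, n))
    (s : seq {mpoly (complex R)[n]}) : pointed A ->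
  exists w, (forall j, 0 < lform w A j) /\ forall p, p \in s ->
    {in msupp p &, forall m m', Adeg A m != Adeg A m' ->
       wdot w (Adeg A m - Adeg A m') != 0}.
Proof.
move=> pA; pose ds := [seq Adeg A m | m <- flatten (map (@msupp _ _) s)].
pose B := [seq b <- [seq x - y | x <- ds, y <- ds] | b != 0].
have [|w [w_gt wB]] := generic_weight (B := B) pA; first by move=> b; rewrite mem_filter => /andP[].
exists w; split=> // p ps m m' mp m'p ne; apply: wB; rewrite mem_filter subr_eq0 ne /=.
have ds_in l : l \in msupp p -> Adeg A l \in ds.
  by move=> lp; apply/map_f/flattenP; exists (msupp p) => //; exact: map_f.
by apply/allpairsP; exists (Adeg A m, Adeg A m'); rewrite /= !ds_in.
Qed.

Lemma curve_poly_torus (R : realType) d n (A : 'M[int]_(d, n)) (tau : {set 'I_n}) w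
    (p : {mpoly (complex R)[n]}) (s : complex R) :
  (forall j, 0 < lform w A j) -> s != 0 ->
  (curve_poly (ind R tau) (fun j => absz (lform w A j)) p).[s] =
  p.@[tact A (fun i => s ^ w i) (ind R tau)].
Proof.
move=> w_gt s0; set k := fun j => _.
transitivity (curve_poly (tact A (fun=> 1) (ind R tau)) k p).[s].
  rewrite !horner_curve; apply: meval_eq => j; rewrite /tact big1 ?mul1r // => i _.
  by rewrite exp1rz.
transitivity (p.@[tact A (fun i => 1 * s ^ w i) (ind R tau)]).
  apply: horner_curve_torus => // [i|j _]; first exact: oner_neq0.
  by rewrite /k gtz0_abs.
by apply: meval_eq => j; rewrite /tact; under eq_bigr do rewrite mul1r.
Qed.

(** For the converse, vanishing along one one-parameter subgroup of generic weight is enough. *)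
Lemma torus_vanishP (R : realType) d n (A : 'M[int]_(d, n)) (tau : {set 'I_n})
    (p : {mpoly (complex R)[n]}) : pointed A ->
  tau_ideal A tau p <-> torus_vanish A tau p.
Proof.
move=> pA; split=> [|pv]; first exact: tau_ideal_torus_vanish.
have [w [w_gt /(_ p (mem_head _ _)) w_sep]] := generic_weight_msupp [:: p] pA.
apply: (curve_poly_eq0 w_gt w_sep); apply: poly_eq0_infinite => s s0.
by rewrite curve_poly_torus // pv // => i; rewrite expfz_neq0.
Qed.

(** A weight generic for both factors turns them into univariate polynomials over a field, where a
    zero product has a zero factor. *)
Lemma tau_ideal_prime (R : realType) d n (A : 'M[int]_(d, n)) (tau : {set 'I_n}) : pointed A ->
  prime_ideal (@tau_ideal R d n A tau).
Proof.
move=> pA; split.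
- split=> [|p q|p q].
  + by apply/torus_vanishP => // eta _; rewrite meval0.
  + rewrite !torus_vanishP // => pv qv eta eta0.
    by rewrite mevalD pv ?qv ?addr0.
  + by rewrite !torus_vanishP // => qv eta eta0; rewrite mevalM qv ?mulr0.
- move=> /(torus_vanishP _ _ pA)/(_ (fun=> 1) (fun=> oner_neq0 _))/eqP.
  by rewrite meval1 oner_eq0.
- move=> p q /(torus_vanishP _ _ pA) pqv.
  have [w [w_gt w_sep]] := generic_weight_msupp [:: p; q] pA.
  set k := fun j => absz (lform w A j).
  have /eqP : curve_poly (ind R tau) k p * curve_poly (ind R tau) k q = 0.
    apply: poly_eq0_infinite => s s0; rewrite hornerM !curve_poly_torus // -mevalM pqv //.
    by move=> i; rewrite expfz_neq0.
  rewrite mulf_eq0 => /orP[/eqP p0|/eqP q0]; [left|right];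
    by apply: (curve_poly_eq0 w_gt (w_sep _ _)) => //; rewrite !inE eqxx ?orbT.
Qed.

Lemma mcoeff_sum_msupp n (K : nzRingType) (p : {mpoly K[n]}) (P : pred 'X_{1..n}) m :
  (\sum_(m' <- msupp p | P m') p@_m' *: 'X_[m'])@_m = if P m then p@_m else 0.
Proof.
rewrite linear_sum /= -big_filter; under eq_bigr do rewrite mcoeffZ mcoeffX.
have [mp|mp] := boolP (m \in [seq m' <- msupp p | P m']); last first.
  rewrite big_seq big1 => [|m' m'p].
    by move: mp; rewrite mem_filter; case: (P m) => //= /memN_msupp_eq0->.
  by case: eqP => [e|]; rewrite ?mulr0 //; rewrite -e m'p in mp.
rewrite (bigD1_seq m) ?filter_uniq ?msupp_uniq //= eqxx mulr1 big1 => [|m' /negPf->].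
  by move: mp; rewrite mem_filter addr0 => /andP[->].
by rewrite mulr0.
Qed.

Lemma msupp_sum_sub n (K : nzRingType) (p : {mpoly K[n]}) (P : pred 'X_{1..n}) :
  {subset msupp (\sum_(m' <- msupp p | P m') p@_m' *: 'X_[m']) <= msupp p}.
Proof. by move=> m; rewrite !mcoeff_msupp mcoeff_sum_msupp; case: ifP; rewrite ?eqxx. Qed.

Lemma tau_ideal_graded (R : realType) d n (A : 'M[int]_(d, n)) (tau : {set 'I_n}) :
  graded A (@tau_ideal R d n A tau).
Proof.
move=> p pt b c; rewrite (big_msupp _ (msupp_uniq p)); last exact: msupp_sum_sub.
have [<-|bc] := eqVneq b c.
  by rewrite -[RHS](pt b); apply: eq_bigr => m /andP[/eqP mb _]; rewrite mcoeff_sum_msupp mb eqxx.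
apply: big1 => m /andP[/eqP mc _]; rewrite mcoeff_sum_msupp mc.
by rewrite eq_sym (negPf bc).
Qed.

(** * Weights of monomials, initial forms and binomials *)

Definition hdeg d (h : 'rV[rat]_d) (b : 'cV[int]_d) : rat :=
  \sum_i h ord0 i * (b i ord0)%:~R.

(** The difference of the two weights is the sum of the nonnegative terms [(L_j - h . a_j) m_j], and
    [L_j - h . a_j] is zero exactly on [tau]. *)
Lemma Lwt_supports d n (A : 'M[int]_(d, n)) L (tau : {set 'I_n}) h (m : 'X_{1..n}) :
  supports A L tau h ->
  hdeg h (Adeg A m) <= Lwt L m /\ (hdeg h (Adeg A m) == Lwt L m) = msub tau m.
Proof.
move=> hP.
have LE : Lwt L m - hdeg h (Adeg A m) = \sum_j (L j - dotp h (colq A j)) * (m j)%:R.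
  have -> : hdeg h (Adeg A m) = \sum_j dotp h (colq A j) * (m j)%:R.
    rewrite /hdeg; under eq_bigr do rewrite AdegE rmorph_sum mulr_sumr.
    rewrite exchange_big; apply: eq_bigr => j _; rewrite mulr_suml.
    by apply: eq_bigr => i _; rewrite /= intrM colqE mulrA.
  by rewrite -sumrB; apply: eq_bigr => j _; rewrite mulrBl.
have ge0 j : 0 <= (L j - dotp h (colq A j)) * (m j)%:R.
  by rewrite mulr_ge0 // subr_ge0; case: (hP j).
split; first by rewrite -subr_ge0 LE sumr_ge0.
rewrite eq_sym -subr_eq0 LE psumr_eq0 //; apply/allP/forallP => [h0 j|mt j _].
  have := h0 j (mem_index_enum j); rewrite /= mulf_eq0 pnatr_eq0 subr_eq0.
  by case: (hP j) => _ ->; rewrite [L j == _]eq_sym orbC implyNb.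
have := mt j; rewrite /= mulf_eq0 pnatr_eq0 subr_eq0.
by case: (hP j) => _ ->; rewrite [L j == _]eq_sym orbC implyNb.
Qed.

Lemma gen_ideal_sub (R : realType) n (G J : {mpoly (complex R)[n]} -> Prop) :
  is_ideal J -> (forall q, G q -> J q) -> forall p, gen_ideal G p -> J p.
Proof.
move=> [J0 JD JM] GJ p [s [sG ->]]; rewrite big_seq.
by apply: big_ind => // x xs; apply/JM/GJ/sG.
Qed.

Lemma gen_ideal_mem (R : realType) n (G : {mpoly (complex R)[n]} -> Prop) q p :
  G p -> gen_ideal G (q * p).
Proof.
move=> Gp; exists [:: (q, p)]; split; last by rewrite big_seq1.
by move=> x; rewrite inE => /eqP->.
Qed.

Lemma msubT n (m : 'X_{1..n}) : msub setT m.
Proof. by apply/forallP => j; rewrite inE implybT. Qed.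

Lemma uposB n (u : 'cV[int]_n) j : (upos u j)%:Z - (uneg u j)%:Z = u j ord0.
Proof. by rewrite !mnmE; case: ltrgtP => // h; lia. Qed.

Lemma AdegB d n (A : 'M[int]_(d, n)) (m m' : 'X_{1..n}) :
  Adeg A m - Adeg A m' = A *m \col_j ((m j)%:Z - (m' j)%:Z).
Proof. by rewrite /Adeg -mulmxBr; congr (_ *m _); apply/colP=> j; rewrite !mxE. Qed.

Lemma Adeg_upos_uneg d n (A : 'M[int]_(d, n)) (u : 'cV[int]_n) :
  A *m u = 0 -> Adeg A (upos u) = Adeg A (uneg u).
Proof.
move=> Au; apply/eqP; rewrite -subr_eq0 AdegB -[X in _ == X]Au; apply/eqP.
by congr (_ *m _); apply/colP=> j; rewrite mxE uposB.
Qed.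

Lemma toric_ideal_tau (R : realType) d n (A : 'M[int]_(d, n)) (p : {mpoly (complex R)[n]}) :
  pointed A -> toric_ideal A p -> tau_ideal A setT p.
Proof.
move=> pA; have [idT _ _] := @tau_ideal_prime R d n A setT pA.
apply: (gen_ideal_sub idT) => _ [u [Au ->]]; apply/torus_vanishP => // eta eta0.
have evX m : ('X_[m] : {mpoly (complex R)[n]}).@[tact A eta (ind R setT)]
    = chi eta (Adeg A m).
  rewrite mevalX /tact; under eq_bigr do rewrite exprMn.
  by rewrite big_split /= prod_ind msubT mulr1 chi_Adeg.
by rewrite mevalB !evX (Adeg_upos_uneg Au) subrr.
Qed.

Definition Ltop (R : realType) n L (p : {mpoly (complex R)[n]}) (m : 'X_{1..n}) :=
  all (fun m' => Lwt L m' <= Lwt L m) (msupp p).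

(* If some monomial of degree [b] counted on the left occurs in [initL p], then
   [hdeg h b] is the top weight of [p]; every monomial of [p] of degree [b] has weight at
   least [hdeg h b], hence belongs to [initL p] and is supported on [tau]. *)
Lemma initL_tau (R : realType) d n (A : 'M[int]_(d, n)) L (tau : {set 'I_n}) h
    (p : {mpoly (complex R)[n]}) :
  supports A L tau h -> tau_ideal A setT p -> tau_ideal A tau (initL L p).
Proof.
move=> hP pT b; rewrite (big_msupp _ (msupp_uniq p)); last exact: msupp_sum_sub.
under eq_bigr do rewrite mcoeff_sum_msupp -/(Ltop L p _).
rewrite -big_mkcondr /=.
have [/hasP[m0 m0p /andP[/andP[/eqP m0b m0t] m0L]]|/hasPn no] :=
  boolP (has (fun m => (Adeg A m == b) && msub tau m && Ltop L p m) (msupp p)); last first.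
  by rewrite big_seq_cond big1 // => m /andP[/no/negPf->].
rewrite -[RHS](pT b) big_seq_cond [RHS]big_seq_cond; apply: eq_bigl => m.
case mp: (m \in msupp p) => //=; rewrite -/(msub _ m) -/(msub setT m) msubT andbT.
case: eqP => //= mb; have [le_m eq_m] := Lwt_supports m hP.
have [_] := Lwt_supports m0 hP; rewrite m0t => /eqP e0.
have m_le : Lwt L m <= Lwt L m0 := allP m0L m mp.
have em : Lwt L m = Lwt L m0.
  by apply/le_anti; rewrite m_le -e0 m0b -mb le_m.
rewrite -eq_m mb -m0b e0 em eqxx /=; apply/allP => m' /(allP m0L).
by rewrite em.
Qed.

Lemma grL_tau (R : realType) d n (A : 'M[int]_(d, n)) L (tau : {set 'I_n}) h
    (p : {mpoly (complex R)[n]}) : pointed A ->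
  supports A L tau h -> grL L (toric_ideal A) p -> tau_ideal A tau p.
Proof.
move=> pA hP; have [idT _ _] := @tau_ideal_prime R d n A tau pA.
apply: (gen_ideal_sub idT) => _ [q [qI ->]].
by apply: (initL_tau hP); exact: toric_ideal_tau.
Qed.

(** Dividing by the gcd ['X_[g]] of the two monomials leaves a generator. *)
Lemma toric_binomial (R : realType) d n (A : 'M[int]_(d, n)) (m m' : 'X_{1..n}) :
  Adeg A m = Adeg A m' ->
  toric_ideal A ('X_[m] - 'X_[m'] : {mpoly (complex R)[n]}).
Proof.
move=> e; pose u : 'cV[int]_n := \col_j ((m j)%:Z - (m' j)%:Z).
pose g : 'X_{1..n} := [multinom minn (m j) (m' j) | j < n].
have -> : 'X_[m] - 'X_[m'] = 'X_[g] * ('X_[upos u] - 'X_[uneg u]) :> {mpoly (complex R)[n]}.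
  rewrite mulrBr -!mpolyXD; congr ('X_[_] - 'X_[_]); apply/mnmP => j;
    by rewrite mnmDE !mnmE mxE; case: ltrP; lia.
apply: gen_ideal_mem; exists u; split=> //.
by rewrite /u -AdegB e subrr.
Qed.

Lemma mcoeff_binomial (R : realType) n (m m' k : 'X_{1..n}) :
  ('X_[m] - 'X_[m'] : {mpoly (complex R)[n]})@_k = (m == k)%:R - (m' == k)%:R.
Proof. by rewrite mcoeffB !mcoeffX. Qed.

Lemma msupp_binomial (R : realType) n (m m' k : 'X_{1..n}) :
  k \in msupp ('X_[m] - 'X_[m'] : {mpoly (complex R)[n]}) -> k = m \/ k = m'.
Proof.
rewrite mcoeff_msupp mcoeff_binomial; have [->|_] := eqVneq m k; first by left.
by have [->|_] := eqVneq m' k; [right|rewrite subrr eqxx].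
Qed.

(** Such a binomial is its own initial form. *)
Lemma grL_binomial_eq (R : realType) d n (A : 'M[int]_(d, n)) L (m m' : 'X_{1..n}) :
  Adeg A m = Adeg A m' -> Lwt L m = Lwt L m' ->
  grL L (toric_ideal A) ('X_[m] - 'X_[m'] : {mpoly (complex R)[n]}).
Proof.
move=> e eL; rewrite -[_ - _]mul1r; apply: gen_ideal_mem.
exists ('X_[m] - 'X_[m']); split; first exact: toric_binomial.
apply/mpolyP => k; rewrite mcoeff_sum_msupp.
case: ifPn => // /negP nk; apply/eqP; rewrite mcoeff_eq0; apply/negP => kp.
apply: nk; apply/allP => l /msupp_binomial lE.
by have := msupp_binomial kp; move=> [] ->; case: lE => ->; rewrite ?eL.
Qed.

(** The initial form of the binomial is its heavier term. *)
Lemma grL_binomial_lt (R : realType) d n (A : 'M[int]_(d, n)) L (m m' : 'X_{1..n}) :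
  Adeg A m = Adeg A m' -> Lwt L m' < Lwt L m ->
  grL L (toric_ideal A) ('X_[m] : {mpoly (complex R)[n]}).
Proof.
move=> e ltL; rewrite -[X in grL _ _ X]mul1r; apply: gen_ideal_mem.
exists ('X_[m] - 'X_[m']); split; first exact: toric_binomial.
have mm' : m' == m = false by apply: contraTF ltL => /eqP->; rewrite ltxx.
have mp : m \in msupp ('X_[m] - 'X_[m'] : {mpoly (complex R)[n]}).
  by rewrite mcoeff_msupp mcoeff_binomial eqxx mm' subr0 oner_eq0.
apply/mpolyP => k; rewrite mcoeff_sum_msupp mcoeff_binomial mcoeffX.
have [<-|mk] := eqVneq m k.
  rewrite mm' subr0 ifT //; apply/allP => l /msupp_binomial[]-> //.
  exact: ltW.
have [<-|_] := eqVneq m' k; last by rewrite subrr if_same.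
by rewrite ifF //; apply/negP => /allP/(_ m mp); rewrite leNgt ltL.
Qed.

Lemma Lwt_upos_uneg n (L : 'I_n -> rat) (u : 'cV[int]_n) :
  Lwt L (upos u) - Lwt L (uneg u) = Ldot L u.
Proof.
rewrite -sumrB; apply: eq_bigr => j _; rewrite -mulrBr -uposB intrB.
by rewrite !pmulrn.
Qed.

(** * Primes containing the initial ideal *)

Lemma idealN (R : realType) n (P : {mpoly (complex R)[n]} -> Prop) p :
  is_ideal P -> P p -> P (- p).
Proof. by move=> [_ _ PM] Pp; rewrite -mulN1r; exact: PM. Qed.

Lemma idealZ (R : realType) n (P : {mpoly (complex R)[n]} -> Prop) c p :
  is_ideal P -> P p -> P (c *: p).
Proof. by move=> [_ _ PM] Pp; rewrite -mul_mpolyC; exact: PM. Qed.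

Definition nzset (R : realType) n (P : {mpoly (complex R)[n]} -> Prop) : {set 'I_n} :=
  [set j | `[< ~ P 'X_j >]].

Lemma prime_msub (R : realType) n (P : {mpoly (complex R)[n]} -> Prop) m :
  prime_ideal P -> msub (nzset P) m -> ~ P 'X_[m].
Proof.
move=> [_ P1 PM] /forallP mt; rewrite mpolyXE_id.
apply: (big_ind (fun q => ~ P q)) => // [p q np nq /PM[]//|j _].
elim: (m j) (mt j) => [|k IH] kt; first by rewrite expr0.
have jt := implyP kt isT; rewrite exprS => /PM[|].
  by move: jt; rewrite inE => /asboolP.
by apply: IH; rewrite jt implybT.
Qed.

Lemma ideal_nmsub (R : realType) n (P : {mpoly (complex R)[n]} -> Prop) m :
  is_ideal P -> ~~ msub (nzset P) m -> P 'X_[m].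
Proof.
move=> [_ _ PM]; rewrite negb_forall => /existsP[j]; rewrite negb_imply inE.
move=> /andP[mj /negP nj]; have Pj : P 'X_j by apply: contrapT => h; apply: nj; apply/asboolP.
rewrite mpolyXE_id (bigD1 j) //=; case: (m j) mj => // k _.
by rewrite exprS -mulrA mulrC; exact: PM.
Qed.

Lemma prime_supports (R : realType) d n (A : 'M[int]_(d, n)) L
    (P : {mpoly (complex R)[n]} -> Prop) :
  prime_ideal P -> (forall p, grL L (toric_ideal A) p -> P p) ->
  exists h, supports A L (nzset P) h.
Proof.
move=> primeP grP; have [idP _ _] := primeP; have [_ PD _] := idP.
have [//|[u [Au u_ge Lu_le Lu]]] := supports_alternative A L (nzset P).
have e := Adeg_upos_uneg Au.
have un_sub : msub (nzset P) (uneg u).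
  apply/forallP => j; apply/implyP; rewrite mnmE; case: ifP => // uj _.
  by apply/negPn/negP => /u_ge; rewrite leNgt uj.
case: (prime_msub primeP un_sub).
(* If [Ldot L u] is negative, ['X_[uneg u]] is itself an initial form. If it is zero, the whole
   binomial is one, and a positive entry of [u] off [nzset P] puts ['X_[upos u]] in [P]. *)
have [Lu_lt|Lu_eq] := eqVneq (Ldot L u) 0; last first.
  apply: grP; apply: (grL_binomial_lt _ (esym e)).
  by rewrite -subr_lt0 Lwt_upos_uneg lt_neqAle Lu_eq.
have [|[j jt uj]] := Lu; first by rewrite Lu_lt ltxx.
have eL : Lwt L (upos u) = Lwt L (uneg u) by apply/subr0_eq; rewrite Lwt_upos_uneg.
have Pup : P 'X_[upos u].
  apply: ideal_nmsub => //; rewrite negb_forall; apply/existsP; exists j.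
  rewrite negb_imply jt andbT mnmE ifT ?(ltW uj) // absz_eq0; exact: lt0r_neq0.
rewrite -['X_[uneg u]](subKr 'X_[upos u]); apply: PD => //.
by apply: (idealN idP); apply: grP; exact: grL_binomial_eq.
Qed.

(** Monomials not supported on [tau] lie in [P]; those of degree [b] supported on [tau] share the
    weight [hdeg h b], so their differences are initial forms. The condition on [m0] is vacuous when
    [p] has none of the latter. *)
Lemma hcomp_mod_ideal (R : realType) d n (A : 'M[int]_(d, n)) L (tau : {set 'I_n}) h
    (P : {mpoly (complex R)[n]} -> Prop) p b m0 :
  is_ideal P -> (forall p, grL L (toric_ideal A) p -> P p) ->
  supports A L tau h -> (forall m, ~~ msub tau m -> P 'X_[m]) ->
  (forall m, m \in msupp p -> Adeg A m = b -> msub tau m ->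
     msub tau m0 /\ Adeg A m0 = b) ->
  P (hcomp A b p - (\sum_(m <- msupp p | (Adeg A m == b) && msub tau m) p@_m) *: 'X_[m0]).
Proof.
move=> idP grP hP Pn m0P; have [P0 PD PM] := idP.
rewrite /hcomp (bigID (msub tau)) /= addrAC scaler_suml -sumrB.
apply: (PD); rewrite big_seq_cond; apply: big_ind => // m.
  move=> /andP[mp /andP[/eqP mb mt]]; have [m0t m0b] := m0P m mp mb mt.
  rewrite -scalerBr; apply: (idealZ _ idP); apply: grP.
  apply: grL_binomial_eq; first by rewrite mb m0b.
  have [_] := Lwt_supports m hP; have [_] := Lwt_supports m0 hP.
  by rewrite m0t mt mb m0b => /eqP<- /eqP<-.
by move=> /andP[_ /andP[_ /Pn mn]]; exact: idealZ.
Qed.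

Lemma graded_prime_tau (R : realType) d n (A : 'M[int]_(d, n)) L
    (P : {mpoly (complex R)[n]} -> Prop) h :
  prime_ideal P -> graded A P -> (forall p, grL L (toric_ideal A) p -> P p) ->
  supports A L (nzset P) h -> forall p, P p <-> tau_ideal A (nzset P) p.
Proof.
move=> primeP gP grP hP p; have [idP _ _] := primeP; have [P0 PD _] := idP.
have Pn m : ~~ msub (nzset P) m -> P 'X_[m] := ideal_nmsub idP.
split=> [Pp b|tp].
  have [/hasP[m0 m0p /andP[/eqP m0b m0t]]|/hasPn no] :=
    boolP (has (fun m => (Adeg A m == b) && msub (nzset P) m) (msupp p)); last first.
    by rewrite big_seq_cond big1 // => m /andP[/no/negPf->].
  rewrite -[LHS]/(\sum_(m <- msupp p | (Adeg A m == b) && msub (nzset P) m) p@_m).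
  (* Modulo [P] the component of degree [b] is [c *: 'X_[m0]]. By gradedness it lies in [P], while
     ['X_[m0]] does not, so [c] is zero. *)
  set c := \sum_(_ <- _ | _) _.
  have Pc : P (c *: 'X_[m0]).
    rewrite -[_ *: _](subKr (hcomp A b p)); apply: PD; first exact: gP.
    by apply: (idealN idP); apply: (hcomp_mod_ideal idP grP hP).
  apply/eqP/negPn/negP => c0; apply: (prime_msub primeP m0t).
  by rewrite -['X_[m0]](scalerK c0); exact: idealZ.
have -> : p = \sum_(b <- undup (map (Adeg A) (msupp p))) hcomp A b p.
  by rewrite [LHS]mpolyE (sum_fibers _ _ (Adeg A)).
apply: big_ind => // b _; rewrite -[hcomp A b p]subr0.
have [/hasP[m0 m0p /andP[/eqP m0b m0t]]|/hasPn no] :=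
    boolP (has (fun m => (Adeg A m == b) && msub (nzset P) m) (msupp p)).
  rewrite -(scale0r 'X_[m0]) -(tp b).
  exact: (hcomp_mod_ideal idP grP hP).
(* No monomial of [p] of degree [b] is supported on [nzset P]; ['X_[0%MM]] is a placeholder with
   coefficient 0. *)
rewrite -(scale0r 'X_[0%MM]) -(tp b); apply: (hcomp_mod_ideal idP grP hP) => //.
by move=> m /no; rewrite negb_and => /orP[/eqP|/negP].
Qed.

(** * Roots of complex numbers and extension of characters *)

Lemma exists_zroot (K : numClosedFieldType) (t : K) (e : int) :
  t != 0 -> (e = 0 -> t = 1) -> exists2 z : K, z != 0 & z ^ e = t.
Proof.
move=> t0; have root_ex k x : x != 0 -> exists2 z : K, z != 0 & z ^+ k.+1 = x.
  move=> x0; exists (k.+1.-root x); last exact: rootCK.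
  by rewrite rootC_eq0.
case: e => [[|k]|k] e1.
- by exists 1; rewrite ?oner_eq0 // e1.
- by have [z z0 zt] := root_ex k t t0; exists z.
- have [|z z0 zt] := root_ex k t^-1; first by rewrite invr_eq0.
  by exists z => //; rewrite NegzE -exprnN zt invrK.
Qed.

Lemma expfz_prod (K : fieldType) (I : Type) (s : seq I) (P : pred I) (F : I -> K)
    (z : int) :
  (\prod_(i <- s | P i) F i) ^ z = \prod_(i <- s | P i) F i ^ z.
Proof. by elim/big_rec2: _ => [|i a b _ <-]; rewrite ?exp1rz // expfzMl. Qed.

Lemma chi_mul (K : fieldType) a b (x : 'I_a -> K) (M : 'M[int]_(a, b)) (v : 'cV[int]_b) :
  (forall i, x i != 0) -> chi (fun l => chi x (col l M)) v = chi x (M *m v).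
Proof.
move=> x0; rewrite /chi; under eq_bigr do rewrite expfz_prod.
rewrite exchange_big; apply: eq_bigr => i _; rewrite mxE -prodfXz //.
by apply: eq_bigr => l _; rewrite mxE exprz_exp.
Qed.

Lemma chi_neq0 (K : fieldType) a (x : 'I_a -> K) v :
  (forall i, x i != 0) -> chi x v != 0.
Proof. by move=> x0; apply/prodf_neq0 => i _; rewrite expfz_neq0. Qed.

Lemma chi0 (K : fieldType) a (x : 'I_a -> K) : chi x 0 = 1.
Proof. by rewrite /chi big1 // => i _; rewrite mxE expr0z. Qed.

Lemma chi_delta (K : fieldType) a (x : 'I_a -> K) j : chi x (delta_mx j 0) = x j.
Proof.
rewrite /chi (bigD1 j) //= mxE !eqxx expr1z big1 ?mulr1 // => i /negPf ij.
by rewrite mxE ij expr0z.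
Qed.

(* A character of the lattice spanned by the columns of [B] extends to [Z^d], because the
   torus is divisible: diagonalise [B] and extract roots. *)
Lemma extend_character (K : numClosedFieldType) d n (B : 'M[int]_(d, n)) (x : 'I_n -> K) :
  (forall j, x j != 0) -> (forall v, B *m v = 0 -> chi x v = 1) ->
  exists eta, (forall i, eta i != 0) /\ forall j, x j = chi eta (col j B).
Proof.
move=> x0 xB; have [U uU [V uV [e _]]] := int_Smith_normal_form B.
set D := \matrix_(i, j) _ => BE.
(* [theta] is the character [x] in the basis of [Z^n] formed by the columns of the inverse of [V],
   where [B] becomes [U *m D]. *)
pose theta l := chi x (col l (invmx V)).
have theta0 l : theta l != 0 by exact: chi_neq0.
have theta1 l : col l D = 0 -> theta l = 1.
  by move=> Dl; apply: xB; rewrite BE colE mulmxA mulmxK // -mulmxA -colE Dl mulmx0.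
(* When the elementary divisor is 0, [theta] is 1 there and any root will do; indices [k] beyond [n]
   get the value 1. *)
have /choice[zeta zetaP] (k : 'I_d) :
    exists z : K, z != 0 /\ forall l : 'I_n, l = k :> nat -> z ^ e`_k = theta l.
  have [kn|nk] := ltnP k n; last first.
    exists 1; split=> [|l lk]; first exact: oner_neq0.
    by have := ltn_ord l; rewrite lk ltnNge nk.
  have [|z z0 zt] := exists_zroot (e := e`_k) (theta0 (Ordinal kn)).
    move=> ek; apply: theta1; apply/colP=> i; rewrite !mxE /=.
    by case: eqP => [->|]; rewrite ?mulr0n ?ek.
  by exists z; split=> // l lk; rewrite zt; congr theta; apply: val_inj.
have zeta0 k : zeta k != 0 by case: (zetaP k).
have zetaD l : chi zeta (col l D) = theta l.
  have [ld|dl] := ltnP l d; last first.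
    have Dl : col l D = 0.
      apply/colP=> i; rewrite !mxE; case: eqP => // il.
      by have := ltn_ord i; rewrite il ltnNge dl.
    by rewrite Dl chi0 theta1.
  rewrite /chi (bigD1 (Ordinal ld)) //= !mxE eqxx mulr1n big1 => [|k kl].
    by rewrite mulr1; have [_] := zetaP (Ordinal ld); apply.
  by rewrite !mxE -(inj_eq val_inj) /= in kl *; rewrite (negPf kl) expr0z.
exists (fun i => chi zeta (col i (invmx U))); split=> [i|j]; first exact: chi_neq0.
rewrite chi_mul // BE -mulmxA colE !mulmxA mulVmx // mul1mx -mulmxA -chi_mul //.
rewrite -[RHS]/(\prod_l _ ^ _); under [RHS]eq_bigr do rewrite zetaD.
rewrite -[RHS]/(chi theta (V *m delta_mx j 0)) chi_mul // mulmxA mulVmx // mul1mx.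
by rewrite chi_delta.
Qed.

(** * Orbits, their closures and the variety of the initial ideal *)

Lemma torus_orbit_supp (R : realType) d n (A : 'M[int]_(d, n)) (tau : {set 'I_n})
    (xi : 'I_n -> complex R) :
  torus_orbit A tau xi -> forall j, (j \in tau) = (xi j != 0).
Proof.
move=> [eta [eta0 xiE]] j; rewrite xiE /tact /ind mulf_eq0 negb_or.
have -> : \prod_i eta i ^ A i j != 0 by apply/prodf_neq0 => i _; rewrite expfz_neq0.
by case: (j \in tau); rewrite ?oner_eq0 ?eqxx.
Qed.

Lemma prime_point (R : realType) n (xi : 'I_n -> complex R) :
  prime_ideal (fun p => p.@[xi] = 0).
Proof.
split; first split.
- exact: meval0.
- by move=> p q p0 q0; rewrite mevalD p0 q0 addr0.
- by move=> p q q0; rewrite mevalM q0 mulr0.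
- by rewrite meval1 => /eqP; rewrite oner_eq0.
- move=> p q /eqP; rewrite mevalM mulf_eq0 => /orP[]/eqP; by [left|right].
Qed.

Lemma nzset_point (R : realType) n (xi : 'I_n -> complex R) :
  nzset (fun p => p.@[xi] = 0) = [set j | xi j != 0].
Proof.
by apply/setP => j; rewrite !inE mevalXU; apply/asboolP/idP => /eqP.
Qed.

(** The extended character is a torus element that carries the indicator vector of the support of
    [xi] to [xi]. *)
Lemma Var_orbit (R : realType) d n (A : 'M[int]_(d, n)) L (xi : 'I_n -> complex R) :
  Var (grL L (toric_ideal A)) xi ->
  exists tau h, supports A L tau h /\ torus_orbit A tau xi.
Proof.
move=> Vxi; have [h] := prime_supports (prime_point xi) Vxi.
rewrite nzset_point; set tau := [set j | _] => hP; exists tau, h; split=> //.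
(* Off [tau] the coordinate becomes 1 and, in [B], the column becomes 0: all values are then nonzero
   and no new relation is imposed. *)
pose x j := if j \in tau then xi j else 1.
have x0 j : x j != 0.
  by rewrite /x; case: ifP => [|_]; [rewrite inE|rewrite oner_eq0].
have xm (m : 'X_{1..n}) : msub tau m -> \prod_j x j ^+ m j = ('X_[m]).@[xi].
  move=> /forallP mt; rewrite mevalX; apply: eq_bigr => j _; rewrite /x.
  by case: ifP => // jt; have := mt j; rewrite jt implybF negbK => /eqP->.
pose B : 'M[int]_(d, n) := \matrix_(i, j) (if j \in tau then A i j else 0).
have [v Bv|eta [eta0 xE]] := extend_character (B := B) x0.
  pose u : 'cV[int]_n := \col_j (if j \in tau then v j ord0 else 0).
  have Au : A *m u = 0.
    rewrite -Bv; apply/colP=> i; rewrite !mxE; apply: eq_bigr => j _; rewrite !mxE.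
    by case: ifP; rewrite ?mulr0 ?mul0r.
  have ut j : u j ord0 != 0 -> j \in tau by rewrite mxE; case: ifP; rewrite ?eqxx.
  have upt : msub tau (upos u).
    apply/forallP => j; apply/implyP; rewrite mnmE; case: ifP => // _.
    by rewrite absz_eq0; exact: ut.
  have unt : msub tau (uneg u).
    apply/forallP => j; apply/implyP; rewrite mnmE; case: ifP => // _.
    by rewrite absz_eq0; exact: ut.
  have e := Adeg_upos_uneg Au.
  (* Both monomials are supported on [tau], so [h] computes their weights from their common
     degree. *)
  have eL : Lwt L (upos u) = Lwt L (uneg u).
    have [_] := Lwt_supports (upos u) hP; have [_] := Lwt_supports (uneg u) hP.
    by rewrite upt unt e => /eqP<- /eqP<-.
  have := Vxi _ (grL_binomial_eq _ e eL); rewrite mevalB -!xm // => /subr0_eq xe.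
  have -> : chi x v = \prod_j (x j ^+ upos u j * (x j ^+ uneg u j)^-1).
    apply: eq_bigr => j _; rewrite exprnP exprnN -expfzDr // uposB mxE.
    by case: ifP => // jt; rewrite /x jt exp1rz.
  rewrite big_split /= xe -big_split big1 // => j _.
  by rewrite /= mulfV // expf_neq0.
exists eta; split=> // j; rewrite /tact /ind.
case: ifP => jt; last by move: jt; rewrite mulr0 inE => /negbFE/eqP.
have := xE j; rewrite /x jt mulr1 => ->.
by apply: eq_bigr => i _; rewrite !mxE jt.
Qed.

(** [xi] is the limit at [s = 0] of a curve in the orbit of [sigma]; a polynomial vanishing for all
    [s != 0] also vanishes there. *)
Lemma orbit_closure (R : realType) d n (A : 'M[int]_(d, n)) L (tau sigma : {set 'I_n})
    h h' (xi : 'I_n -> complex R) :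
  supports A L tau h -> supports A L sigma h' -> tau \subset sigma ->
  torus_orbit A tau xi -> zclosure (torus_orbit A sigma) xi.
Proof.
move=> hP h'P sub [eta [eta0 xiE]] p pv; have [w wP] := supports_weight hP h'P sub.
pose k j := absz (lform w A j).
have Q0 : curve_poly (tact A eta (ind R sigma)) k p = 0.
  apply: poly_eq0_infinite => s s0; rewrite (horner_curve_torus (w := w)) //; last first.
    by move=> j /wP[w_ge _]; rewrite /k gez0_abs.
  apply: pv; exists (fun i => eta i * s ^ w i); split=> // i.
  by rewrite mulf_neq0 ?expfz_neq0.
(* Within [sigma] the exponents are zero exactly on [tau], so [0 ^+ 0 = 1] keeps those coordinates
   and the others become 0. *)
have := congr1 (horner^~ 0) Q0; rewrite horner0 horner_curve => e; rewrite -[RHS]e.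
apply: meval_eq => j; rewrite xiE /tact /ind -mulrA; congr (_ * _).
have [js|js] := boolP (j \in sigma); last first.
  by rewrite mul0r ifF //; apply/negP => /(subsetP sub); rewrite (negPf js).
have [_ wt] := wP j js; rewrite mul1r expr0n /k absz_eq0 wt.
by case: (j \in tau).
Qed.

Theorem theorem3p1 (R : realType) (d n : nat) (A : 'M[int]_(d, n)) :
  full A -> pointed A ->
  forall (L : 'I_n -> rat) (f : 'I_d -> int) (eps : rat),
  0 < eps ->
  (forall j, 0 < lform f A j /\ eps * `|L j| < (lform f A j)%:~R) ->
  (* (a) *)
  (forall P : {mpoly (complex R)[n]} -> Prop,
     [/\ is_ideal P, graded A P, prime_ideal P & forall p, grL L (toric_ideal A) p -> P p]
     <-> exists tau, umbrella A L f eps tau /\ forall p, P p <-> tau_ideal A tau p)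
  /\
  (* (b) *)
  (forall xi : 'I_n -> complex R,
     [/\ Var (grL L (toric_ideal A)) xi <->
           exists tau, umbrella_rk A L f eps d tau /\ zclosure (torus_orbit A tau) xi,
         Var (grL L (toric_ideal A)) xi <->
           exists tau, umbrella A L f eps tau /\ torus_orbit A tau xi
       & forall tau tau', umbrella A L f eps tau -> umbrella A L f eps tau' ->
           torus_orbit A tau xi -> torus_orbit A tau' xi -> tau = tau']).
Proof.
move=> fullA pA L f eps eps0 f_gt.
have umbP := umbrellaP eps0 f_gt.
split=> [P|xi].
  split=> [[idP gP primeP grP]|[tau [/umbP[h hP] Ptau]]].
    have [h hP] := prime_supports primeP grP.
    by exists (nzset P); split; [apply/umbP; exists h|exact: graded_prime_tau hP].
  have [idT T1 TM] := @tau_ideal_prime R d n A tau pA.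
  have [T0 TD Tm] := idT.
  have idP : is_ideal P.
    split; first exact/Ptau.
      by move=> p q /Ptau pt /Ptau qt; apply/Ptau/TD.
    by move=> p q /Ptau qt; apply/Ptau/Tm.
  split=> //.
  - by move=> p /Ptau pt b; apply/Ptau; exact: tau_ideal_graded.
  - split=> //; first by move/Ptau.
    by move=> p q /Ptau/TM[]/Ptau; [left|right].
  - by move=> p /(grL_tau pA hP)/Ptau.
(* The initial ideal lies in [tau_ideal A tau], which vanishes on the orbit of [tau] and hence on
   its closure. *)
have VarT tau h : supports A L tau h -> zclosure (torus_orbit A tau) xi ->
    Var (grL L (toric_ideal A)) xi.
  move=> hP zxi p /(grL_tau pA hP)/tau_ideal_torus_vanish pv.
  apply: zxi => z [eta [eta0 zE]]; rewrite (meval_eq _ zE); exact: pv.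
split.
- split=> [/Var_orbit[tau [h [hP xit]]]|[tau [[F [faceF F0 Ftau _]] zxi]]].
    (* The face [tau] is enlarged to one of dimension [d - 1], whose orbit closure contains the
       orbit of [tau]. *)
    have [sigma [h' [h'P sub full_s]]] := supports_extend fullA hP.
    exists sigma; split; first exact: supports_umbrella_rk h'P full_s.
    exact: orbit_closure xit.
  have /umbP[h hP] : umbrella A L f eps tau by exists F.
  exact: VarT zxi.
- split=> [/Var_orbit[tau [h [hP xit]]]|[tau [/umbP[h hP] xit]]].
    by exists tau; split=> //; apply/umbP; exists h.
  by apply: (VarT tau h hP) => p; apply.
(* Any point of an orbit determines [tau] as its set of nonzero coordinates. *)
- move=> tau tau' _ _ /torus_orbit_supp t /torus_orbit_supp t'.
  by apply/setP => j; rewrite t t'.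
Qed.
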